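(* Let $\mu=\frac12\delta_{1/4}+\mu_a$, where $\mu_a$ is the finite absolutely continuous Borel measure on $[0,1)$ with Radon-Nikodym derivative $\chi_{[\frac12,1)}$ and $\delta_{1/4}$ is the unit point mass at $\frac14$. Then there is a Parseval frame $\{g_n\}_{n=-\infty}^{\infty}$ for $L^2(\mu)$ that is dextrodual to $\{e^{2\pi i n x}\}_{n=-\infty}^{\infty}$ in $L^2(\mu)$.
   Context: Absolute continuity and the Radon-Nikodym derivative are with respect to Lebesgue measure. A sequence $\{g_n\}$ in a Hilbert space $H$ is a Parseval frame if $\sum_n|\langle f,g_n\rangle|^2=\|f\|^2$ for all $f\in H$. A sequence $\{g_n\}$ is dextrodual to a sequence $\{x_n\}$ in $H$ if for all $x\in H$, $x=\sum_n\langle x,g_n\rangle x_n$, with (possibly conditional) convergence in norm; for sequences indexed by $\mathbb Z$ the sum is the limit of the symmetric partial sums $\sum_{n=-M}^{M}$ as $M\to\infty$. *)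

(* Defs.v *)
From mathcomp Require Import all_boot all_order all_algebra.
From mathcomp Require Import all_classical all_reals all_analysis.
From mathcomp.real_closed Require Export complex.

Set Implicit Arguments.
Unset Strict Implicit.
Unset Printing Implicit Defensive.

Import Order.TTheory GRing.Theory Num.Theory.
Import numFieldNormedType.Exports.
Import Normc.

Local Open Scope classical_set_scope.
Local Open Scope ring_scope.

(* A Hilbert space over R[i] is given here by a set H of vectors of an ambient
   lmodule V together with its inner product [dot], linear in the first
   argument. [dot] may be degenerate, i.e. the vectors in H are representatives
   of the elements of the Hilbert space modulo the vectors of norm 0. *)
Section hilbert.
Context (R : realType) (V : lmodType R[i]).
Variables (H : set V) (dot : V -> V -> R[i]).

Definition hnorm (f : V) : R := Num.sqrt (complex.Re (dot f f)).

Definition parseval_frame (I : choiceType) (g : I -> V) : Prop :=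
  (forall n, H (g n)) /\
  (forall f, H f ->
    (\esum_(n in [set: I]) (normc (dot f (g n)) ^+ 2)%:E
       = (hnorm f ^+ 2)%:E)%E).

(* The sum of u n over the integers n with - M <= n <= M. *)
Definition symmetric_sum (u : int -> V) (M : nat) : V :=
  \sum_(k < M.*2.+1) u (k%:Z - M%:Z).

Definition dextrodual (g x : int -> V) : Prop :=
  [/\ (forall n, H (g n)), (forall n, H (x n)) &
      forall f, H f ->
        hnorm (f - symmetric_sum (fun n => dot f (g n) *: x n) M)
          @[M --> \oo] --> (0 : R)].

End hilbert.

Section L2.
Context d (T : measurableType d) (R : realType).
Variable mu : {measure set T -> \bar R}.

(* Functions rather than classes modulo a.e. equality; every notion above only
   depends on the classes when H := L2 and dot := L2dot. *)
Definition L2 : set (T -> R[i]) :=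
  [set f : T -> R[i] |
    [/\ measurable_fun [set: T] (fun x => complex.Re (f x)),
        measurable_fun [set: T] (fun x => complex.Im (f x)) &
        (\int[mu]_x (normc (f x) ^+ 2)%:E < +oo)%E]].

Definition L2dot (f g : T -> R[i]) : R[i] :=
  Complex (\int[mu]_x complex.Re (f x * conjc (g x)))%R
          (\int[mu]_x complex.Im (f x * conjc (g x)))%R.

End L2.

Definition expi (R : realType) (t : R) : R[i] := Complex (cos t) (sin t).

(* Main.v *)
(** [mu] is the image of Lebesgue measure on [0, 1[ under the map [collapse]
    sending [0, 1/2[ to 1/4 and fixing [1/2, 1[, so f |-> F := f \o collapse is an
    isometry of L2(mu) into L2([0, 1[). Take for g_n the image of e^{2 pi i n x}
    under the adjoint of this isometry, so that <f, g_n> is the n-th Fourier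
    coefficient of F. Parseval's identity for F makes {g_n} a Parseval frame, and
    the expansion of f is the Fourier series of F: it converges to F in
    L2([0, 1[), and also at the atom 1/4 by Riemann's localization principle,
    since F is constant on [0, 1/2[.

    Localization is proved by telescoping: if F vanishes near x, then
    F(t) = (e^{2 pi i (t - x)} - 1) G(t) with G in L2, so the n-th term of the
    Fourier series of F at x is a_{n-1} - a_n, where a_n is the n-th term for G,
    which tends to 0 by Bessel's inequality. Applied to indicators of half-lines,
    localization gives convergence almost everywhere, hence Parseval's identity
    by Fatou's lemma; a Dynkin class argument extends it to all of L2. *)
From HB Require Import structures.
Require Import Defs.
From mathcomp Require Import all_boot all_order all_algebra finmap.
From mathcomp Require Import all_classical all_reals all_analysis.
From mathcomp Require Import measurable_realfun ring lra zify.

Set Implicit Arguments.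
Unset Strict Implicit.
Unset Printing Implicit Defensive.

Import Order.TTheory GRing.Theory Num.Theory.
Import numFieldNormedType.Exports.
Import Normc.

Local Open Scope classical_set_scope.
Local Open Scope ring_scope.
Local Open Scope charge_scope.

(** * Real parts, imaginary parts and moduli of complex numbers *)

Section complex_facts.
Variable R : realType.
Implicit Types z w : R[i].

Lemma sqr_normc_ReIm z : normc z ^+ 2 = complex.Re z ^+ 2 + complex.Im z ^+ 2.
Proof. by case: z => a b; rewrite /= sqr_sqrtr// addr_ge0 ?sqr_ge0. Qed.

Lemma cReD z w : complex.Re (z + w) = complex.Re z + complex.Re w.
Proof. by case: z w => [a b] [c d]. Qed.

Lemma cImD z w : complex.Im (z + w) = complex.Im z + complex.Im w.
Proof. by case: z w => [a b] [c d]. Qed.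

Lemma cReM z w : complex.Re (z * w) =
  complex.Re z * complex.Re w - complex.Im z * complex.Im w.
Proof. by case: z w => [a b] [c d]. Qed.

Lemma cImM z w : complex.Im (z * w) =
  complex.Re z * complex.Im w + complex.Im z * complex.Re w.
Proof. by case: z w => [a b] [c d]. Qed.

Lemma cReJ z : complex.Re (conjc z) = complex.Re z.
Proof. by case: z. Qed.

Lemma cImJ z : complex.Im (conjc z) = - complex.Im z.
Proof. by case: z. Qed.

Lemma mulcJ z : z * conjc z = (normc z ^+ 2)%:C%C.
Proof.
rewrite sqr_normc_ReIm; case: z => a b.
by apply/eqP; rewrite eq_complex /=; apply/andP; split; apply/eqP; ring.
Qed.

Lemma cRe_sum (I : Type) (r : seq I) (P : pred I) (F : I -> R[i]) :
  complex.Re (\sum_(i <- r | P i) F i) = \sum_(i <- r | P i) complex.Re (F i).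
Proof. by apply: (big_morph (@complex.Re R)) => //; exact: cReD. Qed.

End complex_facts.

(** * Orthonormal families in a semi-inner product space: Bessel and Parseval *)

Section inner_product.
Context (R : realType) (V : lmodType R[i]).
Variables (H : set V) (dot : V -> V -> R[i]).

(** The axioms are relative to [H] because the integrals defining [L2dot] are known to be additive
    only for square-integrable functions. Positivity concerns the real part alone: Hermitian
    symmetry makes [dot f f] real. *)
Definition semi_inner_product : Prop :=
  [/\ H 0,
      forall a f g, H f -> H g -> H (a *: f + g),
      forall a f g h, H f -> H g -> H h ->
        dot (a *: f + g) h = a * dot f h + dot g h,
      forall f g, H f -> H g -> dot g f = conjc (dot f g) &
      forall f, H f -> 0 <= complex.Re (dot f f)].

Hypothesis Hdot : semi_inner_product.

Let H0 : H 0. Proof. by case: Hdot. Qed.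
Let HP a f g : H f -> H g -> H (a *: f + g).
Proof. by case: Hdot => _ + _ _ _; exact. Qed.

Lemma spZ a f : H f -> H (a *: f).
Proof. by move=> Hf; rewrite -[_ *: _]addr0; exact: HP. Qed.

Lemma spD f g : H f -> H g -> H (f + g).
Proof. by move=> Hf Hg; rewrite -[f]scale1r; exact: HP. Qed.

Lemma spB f g : H f -> H g -> H (f - g).
Proof. by move=> Hf Hg; rewrite addrC -scaleN1r; exact: HP. Qed.

Lemma sp_sum (I : Type) (r : seq I) (F : I -> V) :
  (forall i, H (F i)) -> H (\sum_(i <- r) F i).
Proof. by move=> HF; elim/big_ind : _ => // f g; exact: spD. Qed.

Lemma dotC f g : H f -> H g -> dot g f = conjc (dot f g).
Proof. by case: Hdot => _ _ _ + _; exact. Qed.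

Lemma dotDl f g h : H f -> H g -> H h -> dot (f + g) h = dot f h + dot g h.
Proof.
move=> Hf Hg Hh; rewrite -[f]scale1r; case: Hdot => _ _ + _ _ => ->//.
by rewrite scale1r mul1r.
Qed.

Lemma dot0l h : H h -> dot 0 h = 0.
Proof.
move=> Hh; have := dotDl H0 H0 Hh; rewrite addr0 => /eqP.
by rewrite -subr_eq subrr => /eqP <-.
Qed.

Lemma dotZl a f h : H f -> H h -> dot (a *: f) h = a * dot f h.
Proof.
move=> Hf Hh; rewrite -[_ *: _]addr0; case: Hdot => _ _ + _ _ => ->//.
by rewrite dot0l// addr0.
Qed.

Lemma dotBl f g h : H f -> H g -> H h -> dot (f - g) h = dot f h - dot g h.
Proof.
by move=> Hf Hg Hh; rewrite -scaleN1r dotDl ?dotZl ?mulN1r//; exact: spZ.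
Qed.

Lemma dotDr f g h : H f -> H g -> H h -> dot h (f + g) = dot h f + dot h g.
Proof.
move=> Hf Hg Hh; rewrite (dotC (spD Hf Hg) Hh) dotDl// rmorphD.
by rewrite (dotC Hf Hh) (dotC Hg Hh).
Qed.

Lemma dotZr a f h : H f -> H h -> dot h (a *: f) = conjc a * dot h f.
Proof.
by move=> Hf Hh; rewrite (dotC (spZ a Hf) Hh) dotZl// rmorphM (dotC Hf Hh).
Qed.

Lemma dotBr f g h : H f -> H g -> H h -> dot h (f - g) = dot h f - dot h g.
Proof.
move=> Hf Hg Hh; rewrite (dotC (spB Hf Hg) Hh) dotBl// rmorphB.
by rewrite (dotC Hf Hh) (dotC Hg Hh).
Qed.

Lemma dot_suml (I : Type) (r : seq I) (F : I -> V) h :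
  (forall i, H (F i)) -> H h ->
  dot (\sum_(i <- r) F i) h = \sum_(i <- r) dot (F i) h.
Proof.
move=> HF Hh; elim: r => [|i r ih]; first by rewrite !big_nil dot0l.
by rewrite !big_cons dotDl ?ih//; exact: sp_sum.
Qed.

Lemma dot_sumr (I : Type) (r : seq I) (F : I -> V) h :
  (forall i, H (F i)) -> H h ->
  dot h (\sum_(i <- r) F i) = \sum_(i <- r) dot h (F i).
Proof.
move=> HF Hh; elim: r => [|i r ih].
  by rewrite !big_nil (dotC H0 Hh) dot0l// rmorph0.
by rewrite !big_cons dotDr ?ih//; exact: sp_sum.
Qed.

Local Notation hn := (hnorm dot).

Lemma hnorm_sqr f : H f -> hn f ^+ 2 = complex.Re (dot f f).
Proof. by case: Hdot => _ _ _ _ h Hf; rewrite /hnorm sqr_sqrtr// h. Qed.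

Lemma hnorm_ge0 f : 0 <= hn f. Proof. exact: sqrtr_ge0. Qed.

Lemma dotff f : H f -> dot f f = (hn f ^+ 2)%:C%C.
Proof.
move=> Hf; rewrite hnorm_sqr//; have := dotC Hf Hf.
case: (dot f f) => a b /= [] /eqP; rewrite -addr_eq0 => /eqP bb.
by congr Complex; lra.
Qed.

Lemma hnormD_sqr f g : H f -> H g -> 
  hn (f + g) ^+ 2 = hn f ^+ 2 + hn g ^+ 2 + 2 * complex.Re (dot f g).
Proof.
move=> Hf Hg; rewrite !hnorm_sqr//; last exact: spD.
rewrite dotDl//; last exact: spD.
rewrite !dotDr// !cReD (dotC Hf Hg); case: (dot f g) => a b /=; ring.
Qed.

Lemma hnormZ_sqr a f : H f -> hn (a *: f) ^+ 2 = normc a ^+ 2 * hn f ^+ 2.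
Proof.
move=> Hf; rewrite hnorm_sqr; last exact: spZ.
rewrite dotZl ?dotZr//; last exact: spZ.
by rewrite mulrA mulcJ dotff// -rmorphM.
Qed.

Lemma hnormB_sqr f g : H f -> H g ->
  hn (f - g) ^+ 2 = hn f ^+ 2 + hn g ^+ 2 - 2 * complex.Re (dot f g).
Proof.
move=> Hf Hg; rewrite -scaleN1r hnormD_sqr//; last exact: spZ.
rewrite hnormZ_sqr// dotZr// rmorphN rmorph1 mulN1r sqr_normc_ReIm.
by case: (dot f g) => a b /=; ring.
Qed.

Lemma hnormD_sqr_le f g : H f -> H g ->
  hn (f + g) ^+ 2 <= 2 * hn f ^+ 2 + 2 * hn g ^+ 2.
Proof.
move=> Hf Hg; have := sqr_ge0 (hn (f - g)).
rewrite hnormB_sqr// hnormD_sqr//; lra.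
Qed.

Variable e : int -> V.
Hypothesis He : forall n, H (e n).
Hypothesis orthonormal : forall m n, dot (e m) (e n) = (m == n)%:R.

Definition fourier_sum f M := symmetric_sum (fun n => dot f (e n) *: e n) M.

(** For [f] in [H] this is the squared norm of [fourier_sum f M], by orthonormality. *)
Definition energy f M : R :=
  \sum_(k < M.*2.+1) normc (dot f (e (k%:Z - M%:Z))) ^+ 2.

Lemma fourier_sum_in f M : H (fourier_sum f M).
Proof. by apply: sp_sum => i; exact: spZ. Qed.

Lemma hnorm_fourier_sum f M : H f -> hn (fourier_sum f M) ^+ 2 = energy f M.
Proof.
move=> Hf; rewrite hnorm_sqr; last exact: fourier_sum_in.
rewrite {1}/fourier_sum /symmetric_sum dot_suml; last 2 first.
- by move=> i; exact: spZ.
- exact: fourier_sum_in.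
rewrite cRe_sum; apply: eq_bigr => k _.
rewrite /fourier_sum /symmetric_sum dotZl//; last exact: fourier_sum_in.
rewrite dot_sumr//; last by move=> i; exact: spZ.
rewrite (bigD1 k)//= big1 ?addr0.
  by rewrite dotZr// orthonormal eqxx mulr1 mulcJ.
move=> i ik; rewrite dotZr// orthonormal.
case: eqP => [/addIr [] /esym/eqP|]; last by rewrite mulr0.
by move=> /eqP/val_inj/eqP; rewrite (negbTE ik).
Qed.

Lemma dot_fourier_sum f M : H f -> complex.Re (dot f (fourier_sum f M)) = energy f M.
Proof.
move=> Hf; rewrite dot_sumr//; last by move=> i; exact: spZ.
rewrite cRe_sum; apply: eq_bigr => k _.
by rewrite dotZr// mulrC mulcJ.
Qed.

(** The partial sum is the orthogonal projection of [f]: its squared norm and the real part of its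
    inner product with [f] are both the energy, so expanding the square leaves one copy of it. *)
Lemma bessel_identity f M : H f ->
  hn (f - fourier_sum f M) ^+ 2 = hn f ^+ 2 - energy f M.
Proof.
move=> Hf; rewrite hnormB_sqr//; last exact: fourier_sum_in.
rewrite hnorm_fourier_sum// dot_fourier_sum//; ring.
Qed.

Lemma energy_le f M : H f -> energy f M <= hn f ^+ 2.
Proof. by move=> Hf; rewrite -subr_ge0 -bessel_identity// sqr_ge0. Qed.

Lemma energyS f M : energy f M.+1 = normc (dot f (e (- M.+1%:Z))) ^+ 2 +
  energy f M + normc (dot f (e M.+1%:Z)) ^+ 2.
Proof.
(* Going from M to M + 1 adds one term at each end; the shifts of the index and of M cancel in
   between. *)
rewrite /energy doubleS big_ord_recl big_ord_recr /= -addrA; congr (_ + (_ + _)).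
- by rewrite /= sub0r.
- apply: eq_bigr => k _; congr (normc (dot f (e _)) ^+ 2).
  by rewrite /= /bump /= add1n; lia.
- congr (normc (dot f (e _)) ^+ 2); rewrite /= /bump /= add1n -addnn; lia.
Qed.

Lemma energy_nondecreasing f : nondecreasing_seq (energy f).
Proof.
apply/nondecreasing_seqP => M; rewrite energyS addrAC ler_wpDl//.
by rewrite addr_ge0 ?sqr_ge0.
Qed.

Lemma energy_cvg f : H f -> cvgn (energy f).
Proof.
move=> Hf; apply: nondecreasing_is_cvgn; first exact: energy_nondecreasing.
by exists (hn f ^+ 2) => _ [M _ <-]; exact: energy_le.
Qed.

(** The energies converge, so their increments tend to 0, and each increment is the sum of the
    squared moduli of the two new coefficients. *)
Lemma coef_cvg0 f : H f ->
  normc (dot f (e M%:Z)) ^+ 2 @[M --> \oo] --> (0 : R) /\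
  normc (dot f (e (- M%:Z))) ^+ 2 @[M --> \oo] --> (0 : R).
Proof.
move=> Hf; have cE := energy_cvg Hf.
have dE : energy f M.+1 - energy f M @[M --> \oo] --> (0 : R).
  rewrite -(subrr (limn (energy f))); apply: cvgB => //.
  by rewrite (@cvg_shiftS _ (energy f)).
have D M : energy f M.+1 - energy f M =
    normc (dot f (e (- M.+1%:Z))) ^+ 2 + normc (dot f (e M.+1%:Z)) ^+ 2.
  by rewrite energyS; ring.
split; rewrite -cvg_shiftS /=.
- apply: (squeeze_cvgr _ (@cvg_cst _ _ _ _ _) dE).
  by apply: nearW => M; rewrite sqr_ge0 D ler_wpDl ?sqr_ge0.
- apply: (squeeze_cvgr _ (@cvg_cst _ _ _ _ _) dE).
  by apply: nearW => M; rewrite sqr_ge0 D ler_wpDr ?sqr_ge0.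
Qed.

Lemma fourier_sumP a f g M : H f -> H g ->
  fourier_sum (a *: f + g) M = a *: fourier_sum f M + fourier_sum g M.
Proof.
move=> Hf Hg; rewrite /fourier_sum /symmetric_sum scaler_sumr -big_split /=.
apply: eq_bigr => k _.
by rewrite dotDl ?dotZl ?scalerDl ?scalerA//; exact: spZ.
Qed.

(** By [bessel_identity] this amounts to norm convergence of the Fourier series. Membership in [H]
    is included so that closure properties can be chained. *)
Definition parseval_equality f := H f /\ energy f M @[M --> \oo] --> hn f ^+ 2.

Lemma parseval_equalityP f : H f ->
  parseval_equality f <-> hn (f - fourier_sum f M) ^+ 2 @[M --> \oo] --> (0 : R).
Proof.
move=> Hf; under eq_fun do rewrite bessel_identity//.
split=> [[_ cE]|c0].
  by have := cvgB (cvg_cst (hn f ^+ 2)) cE; rewrite subrr; exact.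
split=> //.
rewrite (_ : energy f = fun M => hn f ^+ 2 - (hn f ^+ 2 - energy f M)).
  by have := cvgB (cvg_cst (hn f ^+ 2)) c0; rewrite subr0; exact.
by apply/funext => M; rewrite opprB addrC subrK.
Qed.

Lemma parseval_equality_lin a f g : parseval_equality f -> parseval_equality g ->
  parseval_equality (a *: f + g).
Proof.
move=> tf tg; have [[Hf _] [Hg _]] := (tf, tg).
move: tf tg => /(parseval_equalityP Hf) cf /(parseval_equalityP Hg) cg.
apply/parseval_equalityP; first exact: HP.
have : 2 * (normc a ^+ 2 * hn (f - fourier_sum f M) ^+ 2) +
       2 * hn (g - fourier_sum g M) ^+ 2 @[M --> \oo] --> (0 : R).
  have := cvgD (cvgMl_tmp (a := 2) (cvgMl_tmp (a := normc a ^+ 2) cf))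
               (cvgMl_tmp (a := 2) cg).
  by rewrite !mulr0 addr0; exact.
apply: squeeze_cvgr (@cvg_cst _ _ _ _ _).
apply: nearW => M; rewrite sqr_ge0 fourier_sumP//.
rewrite (_ : _ - _ = a *: (f - fourier_sum f M) + (g - fourier_sum g M)).
  have HS h := fourier_sum_in h M.
  rewrite -hnormZ_sqr; last exact: spB.
  by apply: hnormD_sqr_le; [apply: spZ|]; exact: spB.
by rewrite scalerBr opprD addrACA.
Qed.

(** The remainder of [f] is the remainder of [f - g], at most the norm of [f - g] by Bessel, plus
    the remainder of [g], which tends to 0. *)
Lemma parseval_equality_closed f : H f ->
  (forall eps : R, 0 < eps ->
    exists2 g, parseval_equality g & hn (f - g) ^+ 2 < eps) ->
  parseval_equality f.
Proof.
move=> Hf approx; apply/parseval_equalityP => //.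
apply/cvgrPdist_lt => eps eps0.
(* [hnormD_sqr_le] doubles each of the two squared norms, whence [eps / 4] for each. *)
have [|g tg fg] := approx (eps / 4); first by rewrite divr_gt0.
have [Hg _] := tg; move: tg => /(parseval_equalityP Hg) cg.
have /cvgrPdist_lt/(_ (eps / 4)) := cg.
rewrite divr_gt0// => /(_ isT); apply: filterS => M.
rewrite !sub0r !normrN !ger0_norm ?sqr_ge0// => gM.
have Hfg := spB Hf Hg; have HS h := fourier_sum_in h M.
rewrite (_ : f - _ = (f - g - fourier_sum (f - g) M) + (g - fourier_sum g M)).
  apply: (le_lt_trans (hnormD_sqr_le _ _)); try exact: spB.
  rewrite bessel_identity//.
  have : 0 <= energy (f - g) M by apply: sumr_ge0 => i _; exact: sqr_ge0.
  lra.
have -> : fourier_sum f M = fourier_sum (f - g) M + fourier_sum g M.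
  by have := fourier_sumP 1 M Hfg Hg; rewrite !scale1r subrK.
by rewrite opprD addrACA subrK.
Qed.

Lemma finite_ballz M : finite_set [set n : int | (`|n| <= M)%N].
Proof.
apply: (@sub_finite_set _ _ [set (k%:Z - M%:Z) | k in `I_M.*2.+1]).
  by move=> n /= nM; exists (absz (n + M%:Z)); rewrite /= -?addnn; lia.
exact: finite_image.
Qed.

Lemma energy_fsum f M : energy f M =
  \sum_(n \in [set n : int | (`|n| <= M)%N]) normc (dot f (e n)) ^+ 2.
Proof.
rewrite /energy (fsbig_ord _ _ (fun k => normc (dot f (e (k%:Z - M%:Z))) ^+ 2)).
apply/esym/reindex_fsbig; split=> [k /= kM|k l _ _ /= /addIr []//|n /= nM].
  by rewrite -addnn in kM; lia.
by exists (absz (n + M%:Z)); rewrite /= -?addnn; lia.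
Qed.

(** The unordered sum is a supremum over finite sets of integers. Each such set lies in some ball
    |n| <= M, and each ball is itself such a set, with sum the M-th energy. *)
Lemma parseval_equality_esum f : parseval_equality f ->
  (\esum_(n in [set: int]) (normc (dot f (e n)) ^+ 2)%:E = (hn f ^+ 2)%:E)%E.
Proof.
move=> [Hf cE]; apply/eqP; rewrite eq_le; apply/andP; split.
  apply: ge_ereal_sup => _ [X [finX _] <-].
  have /finite_seqP[s Xs] := finX.
  pose M := (\max_(n <- s) `|n|)%N.
  apply: (@le_trans _ _ (energy f M)%:E); last by rewrite lee_fin energy_le.
  rewrite energy_fsum -fsumEFin; last exact: finite_ballz.
  apply: lee_fsum_nneg_subset => //; first exact: finite_ballz.
    by move=> n; rewrite Xs !inE /= => ns; exact: leq_bigmax_seq.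
  by move=> n _; rewrite lee_fin sqr_ge0.
have : (energy f M)%:E @[M --> \oo] --> (hn f ^+ 2)%:E.
  by apply: cvg_EFin => //; exact: nearW.
move=> /cvge_to_le; apply; apply: nearW => M.
rewrite energy_fsum -fsumEFin; last by apply: (finite_ballz M).
apply: ereal_sup_ubound; exists [set n : int | (`|n| <= M)%N] => //.
by split; [exact: finite_ballz|].
Qed.

End inner_product.

(** * Measurability and integrability by components; L2 as a semi-inner product space *)

Section complex_measurable.
Context d (T : measurableType d) (R : realType).
Implicit Types f g : T -> R[i].

Definition cmeasurable f :=
  measurable_fun [set: T] (fun x => complex.Re (f x)) /\
  measurable_fun [set: T] (fun x => complex.Im (f x)).

Lemma cmeasurable_cst z : cmeasurable (fun _ => z).
Proof. by split; exact: measurable_cst. Qed.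

Lemma cmeasurableD f g : cmeasurable f -> cmeasurable g ->
  cmeasurable (fun x => f x + g x).
Proof.
move=> [rf mf] [rg mg]; split.
- by under eq_fun do rewrite cReD; exact: measurable_funD.
- by under eq_fun do rewrite cImD; exact: measurable_funD.
Qed.

Lemma cmeasurableM f g : cmeasurable f -> cmeasurable g ->
  cmeasurable (fun x => f x * g x).
Proof.
move=> [rf mf] [rg mg]; split.
- by under eq_fun do rewrite cReM; apply: measurable_funB; exact: measurable_funM.
- by under eq_fun do rewrite cImM; apply: measurable_funD; exact: measurable_funM.
Qed.

Lemma cmeasurableJ f : cmeasurable f -> cmeasurable (fun x => conjc (f x)).
Proof.
move=> [rf mf]; split.
- by under eq_fun do rewrite cReJ.
- by under eq_fun do rewrite cImJ; exact: measurable_funN.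
Qed.

Lemma measurable_normc_sqr f : cmeasurable f ->
  measurable_fun [set: T] (fun x => normc (f x) ^+ 2).
Proof.
move=> [rf mf]; under eq_fun do rewrite sqr_normc_ReIm.
by apply: measurable_funD; exact: measurable_funX.
Qed.

End complex_measurable.

Section real_integrable.
Context d (T : measurableType d) (R : realType).
Variable mu : {measure set T -> \bar R}.
Implicit Types u v : T -> R.

Lemma EFin_integrableZl r u : mu.-integrable [set: T] (EFin \o u) ->
  mu.-integrable [set: T] (EFin \o fun x => r * u x).
Proof. exact: integrableZl. Qed.

Lemma EFin_integrableD u v : mu.-integrable [set: T] (EFin \o u) ->
  mu.-integrable [set: T] (EFin \o v) ->
  mu.-integrable [set: T] (EFin \o fun x => u x + v x).
Proof. exact: integrableD. Qed.

Lemma EFin_integrableB u v : mu.-integrable [set: T] (EFin \o u) ->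
  mu.-integrable [set: T] (EFin \o v) ->
  mu.-integrable [set: T] (EFin \o fun x => u x - v x).
Proof. exact: integrableB. Qed.

End real_integrable.

Section L2_semi_inner_product.
Context d (T : measurableType d) (R : realType).
Variable mu : {measure set T -> \bar R}.
Implicit Types f g : T -> R[i].

Lemma L2_cmeasurable f : L2 mu f -> cmeasurable f.
Proof. by case. Qed.

Lemma L2_integrable f : L2 mu f ->
  mu.-integrable [set: T] (EFin \o fun x => normc (f x) ^+ 2).
Proof.
move=> [rf mf foo]; apply/integrableP; split.
  exact/measurable_EFinP/measurable_normc_sqr.
rewrite (eq_integral (fun x => (normc (f x) ^+ 2)%:E))// => x _.
by rewrite /= ger0_norm ?sqr_ge0.
Qed.

(** Two dominating functions make the statement fit sums; taking one of them to be 0 gives ordinary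
    domination. *)
Lemma L2_dominated f g h : cmeasurable f -> L2 mu g -> L2 mu h ->
  (forall x, normc (f x) ^+ 2 <= normc (g x) ^+ 2 + normc (h x) ^+ 2) ->
  L2 mu f.
Proof.
move=> mf Lg Lh fgh; split; [by case: mf..|].
have /integrableP[_] : mu.-integrable [set: T]
    (EFin \o fun x => normc (f x) ^+ 2).
  have Igh := integrableD measurableT (L2_integrable Lg) (L2_integrable Lh).
  apply: (le_integrable _ _ _ Igh) => //.
    exact/measurable_EFinP/measurable_normc_sqr.
  by move=> x _ /=; rewrite lee_fin !ger0_norm ?addr_ge0 ?sqr_ge0//.
rewrite (eq_integral (fun x => (normc (f x) ^+ 2)%:E))// => x _.
by rewrite /= ger0_norm ?sqr_ge0.
Qed.

Lemma L2_mulJ_integrable f g : L2 mu f -> L2 mu g ->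
  mu.-integrable [set: T] (EFin \o fun x => complex.Re (f x * conjc (g x))) /\
  mu.-integrable [set: T] (EFin \o fun x => complex.Im (f x * conjc (g x))).
Proof.
move=> Lf Lg; have [mre mim] :=
  cmeasurableM (L2_cmeasurable Lf) (cmeasurableJ (L2_cmeasurable Lg)).
have Ifg := integrableD measurableT (L2_integrable Lf) (L2_integrable Lg).
split; apply: (le_integrable _ _ _ Ifg) => //; try exact/measurable_EFinP.
- move=> x _ /=; rewrite lee_fin [leRHS]ger0_norm ?addr_ge0 ?sqr_ge0//.
  rewrite !sqr_normc_ReIm; case: (f x) (g x) => a b [a' b'] /=.
  (* These squares give 2|a a'| <= a^2 + a'^2 and likewise for b, which bounds the real part
     linearly; the imaginary part below pairs a with b' and b with a'. *)
  have := (sqr_ge0 (a + a'), sqr_ge0 (a - a'), sqr_ge0 (b + b'), sqr_ge0 (b - b')).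
  have := (sqr_ge0 a, sqr_ge0 b, sqr_ge0 a', sqr_ge0 b').
  move=> [[[? ?] ?] ?] [[[? ?] ?] ?]; rewrite ler_norml; apply/andP; split; lra.
- move=> x _ /=; rewrite lee_fin [leRHS]ger0_norm ?addr_ge0 ?sqr_ge0//.
  rewrite !sqr_normc_ReIm; case: (f x) (g x) => a b [a' b'] /=.
  have := (sqr_ge0 (a + b'), sqr_ge0 (a - b'), sqr_ge0 (b + a'), sqr_ge0 (b - a')).
  have := (sqr_ge0 a, sqr_ge0 b, sqr_ge0 a', sqr_ge0 b').
  move=> [[[? ?] ?] ?] [[[? ?] ?] ?]; rewrite ler_norml; apply/andP; split; lra.
Qed.

Lemma L2Z a f : L2 mu f -> L2 mu (a *: f).
Proof.
move=> Lf; have [rf mf foo] := Lf.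
have [mr mi] := cmeasurableM (cmeasurable_cst _ a) (L2_cmeasurable Lf).
split => //.
under eq_integral do rewrite [normc _]normcM exprMn EFinM.
rewrite ge0_integralZl//; first by rewrite lte_mul_pinfty// lee_fin sqr_ge0.
- exact/measurable_EFinP/measurable_normc_sqr.
- by move=> x _; rewrite lee_fin sqr_ge0.
- by rewrite lee_fin sqr_ge0.
Qed.

Lemma L2D f g : L2 mu f -> L2 mu g -> L2 mu (f + g).
Proof.
move=> Lf Lg.
(* The bound is |f + g|^2 <= 2|f|^2 + 2|g|^2 <= |2f|^2 + |2g|^2. *)
apply: (@L2_dominated _ ((2%:R)%:C%C *: f) ((2%:R)%:C%C *: g)).
- exact: cmeasurableD (L2_cmeasurable Lf) (L2_cmeasurable Lg).
- exact: L2Z.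
- exact: L2Z.
move=> x; rewrite [normc ((_ *: f) x)]normcM [normc ((_ *: g) x)]normcM !exprMn.
rewrite -[(f + g) x]/(f x + g x) !sqr_normc_ReIm cReD cImD /=.
have := (sqr_ge0 (complex.Re (f x) - complex.Re (g x)),
         sqr_ge0 (complex.Im (f x) - complex.Im (g x))).
by move=> [? ?]; nra.
Qed.

Lemma L2_0 : L2 mu (0 : T -> R[i]).
Proof.
split; [exact: measurable_cst..|].
by under eq_integral do rewrite /= expr0n/= addr0 sqrtr0 expr0n; rewrite integral0.
Qed.

Lemma L2_semi_inner_product : semi_inner_product (L2 mu) (L2dot mu).
Proof.
split.
- exact: L2_0.
- by move=> a f g Lf Lg; apply: L2D => //; exact: L2Z.
- move=> a f g h Lf Lg Lh.
  have [fr fi] := L2_mulJ_integrable Lf Lh.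
  have [gr gi] := L2_mulJ_integrable Lg Lh.
  pose F x := f x * conjc (h x); pose G x := g x * conjc (h x).
  have E x : (a *: f + g) x * conjc (h x) = a * F x + G x.
    by rewrite -[(a *: f + g) x]/(a * f x + g x) mulrDl mulrA.
  rewrite /L2dot; apply/eqP; rewrite eq_complex; apply/andP; split; apply/eqP.
  + rewrite cReD cReM /=.
    under eq_Rintegral do rewrite E cReD cReM.
    rewrite RintegralD//; last first.
    - by apply: EFin_integrableB => //; exact: EFin_integrableZl.
    by rewrite RintegralB ?RintegralZl//; exact: EFin_integrableZl.
  + rewrite cImD cImM /=.
    under eq_Rintegral do rewrite E cImD cImM.
    rewrite !RintegralD//; try exact: EFin_integrableZl.
    - by rewrite !RintegralZl.
    by apply: EFin_integrableD => //; exact: EFin_integrableZl.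
- move=> f g Lf Lg; have [r i] := L2_mulJ_integrable Lf Lg.
  rewrite /L2dot /=; congr Complex.
    by apply: eq_Rintegral => x _; rewrite !cReM !cReJ !cImJ; ring.
  rewrite -mulN1r -RintegralZl//.
  by apply: eq_Rintegral => x _; rewrite !cImM !cReJ !cImJ; ring.
- move=> f Lf; rewrite Rintegral_ge0// => x _.
  by rewrite mulcJ sqr_ge0.
Qed.

Lemma hnorm_L2 f : L2 mu f ->
  ((hnorm (L2dot mu) f ^+ 2)%:E = \int[mu]_x (normc (f x) ^+ 2)%:E)%E.
Proof.
move=> Lf; rewrite (hnorm_sqr L2_semi_inner_product)//=.
rewrite /Rintegral fineK.
  by apply: eq_integral => x _; rewrite mulcJ.
apply: integrable_fin_num => //.
by have [] := L2_mulJ_integrable Lf Lf.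
Qed.

Lemma L2_mul_bounded (K : R) f m : cmeasurable m ->
  (forall x, normc (m x) <= K) -> L2 mu f -> L2 mu (fun x => f x * m x).
Proof.
move=> mm mK Lf; apply: (@L2_dominated _ (K%:C%C *: f) 0).
- exact: cmeasurableM (L2_cmeasurable Lf) mm.
- exact: L2Z.
- exact: L2_0.
move=> x; rewrite [normc ((_ *: f) x)]normcM [normc (_ * _)]normcM !exprMn.
rewrite [X in _ <= _ + X](_ : _ = 0) ?addr0; last first.
  by rewrite /= !expr0n /= addr0 sqrtr0 expr0n.
rewrite mulrC ler_wpM2r ?sqr_ge0// [leRHS]sqr_normc_ReIm /= expr0n addr0.
have : 0 <= normc (m x) by case: (m x) => a b; exact: sqrtr_ge0.
by have := mK x; nra.
Qed.

Lemma L2_bounded (K : R) m : (mu [set: T] < +oo)%E -> cmeasurable m ->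
  (forall x, normc (m x) <= K) -> L2 mu m.
Proof.
move=> muoo mm mK.
rewrite (_ : m = fun x => cst (1 : R[i]) x * m x); last first.
  by apply/funext => x; rewrite mul1r.
apply: (@L2_mul_bounded K) => //; split; [exact: measurable_cst..|].
under eq_integral do rewrite /= expr1n expr0n addr0 sqrtr1 expr1n.
by rewrite integral_cst// mul1e.
Qed.

Lemma L2dot_ae_eq f g h : cmeasurable f -> cmeasurable g -> cmeasurable h ->
  {ae mu, forall x, f x = g x} -> L2dot mu f h = L2dot mu g h.
Proof.
move=> mf mg mh fg.
have [rf mfi] := cmeasurableM mf (cmeasurableJ mh).
have [rg mgi] := cmeasurableM mg (cmeasurableJ mh).
rewrite /L2dot /Rintegral; congr Complex; congr fine.
- apply: ae_eq_integral => //; try exact/measurable_EFinP.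
  by apply: filterS fg => x + _; move=> ->.
- apply: ae_eq_integral => //; try exact/measurable_EFinP.
  by apply: filterS fg => x + _; move=> ->.
Qed.

End L2_semi_inner_product.

(** * The exponentials and their integrals over a period *)

Section expi_facts.
Variable R : realType.
Implicit Types s t x : R.

Lemma expi0 : expi (0 : R) = 1.
Proof. by rewrite /expi cos0 sin0. Qed.

Lemma expiD s t : expi (s + t) = expi s * expi t.
Proof.
apply/eqP; rewrite eq_complex cReM cImM /= cosD sinD.
by rewrite addrC [X in _ && (X == _)]addrC !eqxx.
Qed.

Lemma expiJ t : conjc (expi t) = expi (- t).
Proof. by rewrite /expi cosN sinN. Qed.

Lemma normc_expi t : normc (expi t) = 1.
Proof. by rewrite /= cos2Dsin2 sqrtr1. Qed.

Lemma expi2pi_int (n : int) : expi (2 * pi * n%:~R : R) = 1.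
Proof.
have E1 : expi (2 * pi : R) = 1.
  by rewrite mulr_natl /expi cos2pi sin2pi.
have En (m : nat) : expi (2 * pi * m%:R : R) = 1.
  elim: m => [|m ih]; first by rewrite mulr0 expi0.
  by rewrite -(addn1 m) natrD mulrDr mulr1 expiD ih E1 mulr1.
case: n => m; first exact: En.
by rewrite NegzE rmorphN mulrN -expiJ En rmorph1.
Qed.

Definition fexp (n : int) (x : R) := expi (2 * pi * n%:~R * x).

Lemma fexpJ n x : conjc (fexp n x) = fexp (- n) x.
Proof. by rewrite /fexp expiJ rmorphN mulrN mulNr. Qed.

Lemma fexpD m n x : fexp (m + n) x = fexp m x * fexp n x.
Proof. by rewrite /fexp rmorphD mulrDr mulrDl expiD. Qed.

Lemma fexpDr n x y : fexp n (x + y) = fexp n x * fexp n y.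
Proof. by rewrite /fexp mulrDr expiD. Qed.

Lemma fexpNr n x : fexp n (- x) = fexp (- n) x.
Proof. by rewrite /fexp mulrN rmorphN mulrN mulNr. Qed.

Lemma fexp0 x : fexp 0 x = 1.
Proof. by rewrite /fexp mulr0 mul0r expi0. Qed.

Lemma normc_fexp n x : normc (fexp n x) = 1.
Proof. exact: normc_expi. Qed.

Lemma continuous_cosM (a : R) : continuous (fun x => cos (a * x)).
Proof.
move=> x; apply: continuous_comp; last exact: continuous_cos.
exact: mulrl_continuous.
Qed.

Lemma continuous_sinM (a : R) : continuous (fun x => sin (a * x)).
Proof.
move=> x; apply: continuous_comp; last exact: continuous_sin.
exact: mulrl_continuous.
Qed.

Lemma cmeasurable_fexp n : cmeasurable (fexp n : measurableTypeR R -> R[i]).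
Proof.
split; apply: continuous_measurable_fun; [exact: continuous_cosM|exact: continuous_sinM].
Qed.

Local Notation mu := (@lebesgue_measure R).

Lemma integral01_is_derive (F f : R -> R) : continuous f ->
  (forall x, is_derive x 1 F (f x)) ->
  (\int[mu]_(x in `[0%R, 1%R]) (f x)%:E = (F 1 - F 0)%:E)%E.
Proof.
move=> cf dF.
have cF : continuous F.
  move=> x; apply: differentiable_continuous; apply/derivable1_diffP.
  exact: ex_derive.
rewrite (@continuous_FTC2 _ _ F)//.
- exact: continuous_subspaceT.
- split; first by move=> x _; exact: ex_derive.
  + exact/cvg_at_right_filter/cF.
  + exact/cvg_at_left_filter/cF.
- by move=> x _; rewrite derive1E; exact: derive_val.
Qed.

(** The antiderivatives sin(ax)/a and -cos(ax)/a take equal values at 0 and 1, since a is a nonzero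
    integer multiple of 2 pi. *)
Lemma integral_fexp (n : int) : n != 0 ->
  (\int[mu]_(x in `[0%R, 1%R]) (complex.Re (fexp n x))%:E = 0)%E /\
  (\int[mu]_(x in `[0%R, 1%R]) (complex.Im (fexp n x))%:E = 0)%E.
Proof.
move=> n0; rewrite /=; set a := 2 * pi * n%:~R.
have a0 : a != 0 by rewrite !mulf_neq0 ?intr_eq0// gt_eqF// pi_gt0.
have [c1 s1] : cos (a * 1) = 1 :> R /\ sin (a * 1) = 0 :> R.
  by have [] := expi2pi_int n; rewrite -/a mulr1.
have dM x : is_derive x 1 ( *%R a) a 
  by have := is_deriveZ a (is_derive_id x (1 : R)); rewrite [_%:A]mulr1.
split.
- apply: (etrans (@integral01_is_derive (fun x => a^-1 * sin (a * x)) _ _ _)).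
  + exact: continuous_cosM.
  + move=> x.
    have h := is_deriveZ a^-1 (is_derive1_comp (is_derive_sin (a * x)) (dM x)).
    suff <- : a^-1 *: (cos (a * x) * a) = cos (a * x) by exact: h.
    by rewrite [_ *: _]mulrCA mulVf// mulr1.
  + by rewrite s1 !mulr0 sin0 mulr0 subrr.
- apply: (etrans (@integral01_is_derive (fun x => - a^-1 * cos (a * x)) _ _ _)).
  + exact: continuous_sinM.
  + move=> x.
    have h := is_deriveZ (- a^-1) (is_derive1_comp (is_derive_cos (a * x)) (dM x)).
    suff <- : - a^-1 *: (- sin (a * x) * a) = sin (a * x) by exact: h.
    by rewrite [_ *: _]mulrCA [- a^-1 * _]mulNr mulVf// mulrN1 opprK.
  + by rewrite c1 !mulr0 cos0 subrr.
Qed.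

End expi_facts.

(** * Lebesgue measure on [0, 1[ and orthonormality of the exponentials *)

Section unit_interval.
Variable R : realType.

(** A measure on the whole line carried by [0, 1[, so that its L2 functions have the same type as
    those of L2(mu). *)
Definition unit_measure : {measure set (measurableTypeR R) -> \bar R} :=
  mrestr (@lebesgue_measure R) (measurable_itv `[(0 : R), 1[).

Lemma unit_measureE (A : set R) :
  unit_measure A = lebesgue_measure (A `&` `[0, 1[).
Proof. by []. Qed.

Lemma unit_measureT : (unit_measure [set: R] = 1)%E.
Proof.
rewrite unit_measureE setTI lebesgue_measure_itv /= lte_fin ltr01.
by rewrite sube0.
Qed.

(** The endpoint 0 and the point [a] are null. The point [a] leaves room for a singularity, such as
    the jump of an indicator or the zero of a divisor. *)
Lemma ae_unit_measure (a : R) (P : R -> Prop) :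
  (forall x, 0 < x < 1 -> x != a -> P x) -> {ae unit_measure, forall x, P x}.
Proof.
move=> xP; exists (~` `]0, 1[ `|` [set a]); split.
- by apply: measurableU => //; exact: measurableC.
- rewrite unit_measureE; apply/eqP; rewrite -measure_le0.
  have <- : lebesgue_measure [set 0; a] = 0%E :> \bar R.
    by apply: countable_lebesgue_measure0; exact: finite_set_countable.
  apply: le_measure; rewrite ?inE.
  + apply: measurableI => //; apply: measurableU => //; exact: measurableC.
  + exact: measurableU.
  move=> x [[|->]]; last by right.
  rewrite /= !in_itv /= => /negP; rewrite negb_and -!leNgt => x01 /andP[x0 x1].
  left; apply/eqP; rewrite eq_le x0 andbT.
  by case/orP: x01 => // /(lt_le_trans x1); rewrite ltxx.
- move=> x /= nPx; have [->|xa] := eqVneq x a; first by right.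
  by left; rewrite /= in_itv /= => x01; apply: nPx; exact: xP.
Qed.

Lemma integral_unit_measure (f : R -> \bar R) : measurable_fun [set: R] f ->
  (\int[unit_measure]_x f x = \int[lebesgue_measure]_(x in `[0%R, 1%R[) f x)%E.
Proof.
move=> mf; transitivity (\int[unit_measure]_(x in `[0%R, 1%R[) f x)%E.
  rewrite [RHS]integral_mkcond; apply: ae_eq_integral => //.
    by apply/(measurable_restrictT _ _).1 => //; exact: measurable_funTS.
  apply: (@ae_unit_measure 0) => x /andP[x0 x1] _ _.
  by rewrite patchE ifT// inE /= in_itv /= x1 ltW.
by apply: eq_measure_integral => A mA AI; rewrite unit_measureE setIidl.
Qed.

(** The closed interval is the form in which the fundamental theorem of calculus is applied in
    [integral_fexp]. *)
Lemma integral_unit_measure_cc (f : R -> R) : measurable_fun [set: R] f ->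
  (\int[unit_measure]_x (f x)%:E =
   \int[lebesgue_measure]_(x in `[0%R, 1%R]) (f x)%:E)%E.
Proof.
move=> mf; rewrite integral_unit_measure; last exact/measurable_EFinP.
rewrite integral_itv_bndo_bndc//.
by apply/measurable_EFinP; exact: measurable_funTS.
Qed.

Lemma L2_unit_bounded (K : R) (m : measurableTypeR R -> R[i]) : cmeasurable m ->
  (forall x, normc (m x) <= K) -> L2 unit_measure m.
Proof. by apply: L2_bounded; rewrite unit_measureT ltry. Qed.

Lemma L2_fexp n : L2 unit_measure (fexp n : measurableTypeR R -> R[i]).
Proof.
apply: (@L2_unit_bounded 1); first exact: cmeasurable_fexp.
by move=> x; rewrite normc_fexp.
Qed.

Lemma fexp_orthonormal m n :
  L2dot unit_measure (fexp m : measurableTypeR R -> R[i]) (fexp n) = (m == n)%:R.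
Proof.
rewrite /L2dot; under eq_Rintegral do rewrite fexpJ -fexpD.
under [X in Complex _ X]eq_Rintegral do rewrite fexpJ -fexpD.
have [mr mi] := cmeasurable_fexp R (m - n).
rewrite /Rintegral !integral_unit_measure_cc//.
have [->|mn] := eqVneq m n; last first.
  have mn0 : m - n != 0 by rewrite subr_eq0.
  by have [-> ->] := integral_fexp R mn0.
rewrite subrr.
under eq_integral do rewrite fexp0.
under [X in Complex _ (fine X)]eq_integral do rewrite fexp0.
by rewrite integral0 integral_cst//= lebesgue_measure_itv /= lte_fin ltr01 sube0 mule1.
Qed.

End unit_interval.

(** * Convergence of complex sequences *)

Section complex_cvg.
Variable R : realType.
Implicit Types (u v : nat -> R[i]) (l : R[i]).

Lemma normc_ge0 (z : R[i]) : 0 <= normc z.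
Proof. by case: z => a b; exact: sqrtr_ge0. Qed.

Lemma sqr_normcD_le (z w : R[i]) :
  normc (z + w) ^+ 2 <= 2 * normc z ^+ 2 + 2 * normc w ^+ 2.
Proof.
rewrite !sqr_normc_ReIm cReD cImD.
have := (sqr_ge0 (complex.Re z - complex.Re w),
         sqr_ge0 (complex.Im z - complex.Im w)).
by move=> [? ?]; nra.
Qed.

(* [ccvg u l] avoids choosing a topology on [R[i]]. *)
Definition ccvg u l := normc (u n - l) ^+ 2 @[n --> \oo] --> (0 : R).

Lemma sqr_cvg0 (u : nat -> R) : u n ^+ 2 @[n --> \oo] --> 0 -> u @ \oo --> 0.
Proof.
move=> u0; apply/norm_cvg0P.
rewrite (_ : (fun _ => _) = fun n => Num.sqrt (u n ^+ 2)).
  by have := continuous_cvg _ (@sqrt_continuous R 0) u0; rewrite sqrtr0; exact.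
by apply/funext => n; rewrite sqrtr_sqr.
Qed.

Lemma ccvg_ReIm u l : ccvg u l ->
  complex.Re (u n) @[n --> \oo] --> complex.Re l /\
  complex.Im (u n) @[n --> \oo] --> complex.Im l.
Proof.
move=> ul; split; apply/subr_cvg0; apply: sqr_cvg0;
  apply: (squeeze_cvgr _ (@cvg_cst _ _ _ _ _) ul); apply: nearW => n;
  rewrite sqr_ge0 sqr_normc_ReIm cReD cImD; case: l {ul} => a b /=;
  [by rewrite lerDl sqr_ge0|by rewrite lerDr sqr_ge0].
Qed.

Lemma ccvg_sqr_normc u l : ccvg u l ->
  normc (u n) ^+ 2 @[n --> \oo] --> normc l ^+ 2.
Proof.
move=> /ccvg_ReIm[ur ui]; rewrite sqr_normc_ReIm.
under eq_fun do rewrite sqr_normc_ReIm.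
by apply: cvgD; apply: cvgM.
Qed.

End complex_cvg.

(** * Riemann localization by telescoping *)

Section localization.
Variable R : realType.
Implicit Types (F : measurableTypeR R -> R[i]) (x : R).

Local Notation nu := (@unit_measure R).
Local Notation E := (@fexp R : int -> measurableTypeR R -> R[i]).
Local Notation S := (fourier_sum (L2dot nu) E).

Lemma fourier_sumE F M x : S F M x =
  \sum_(k < M.*2.+1) L2dot nu F (E (k%:Z - M%:Z)) * fexp (k%:Z - M%:Z) x.
Proof. by rewrite /fourier_sum /symmetric_sum fct_sumE. Qed.

(** Evenness and the reflection of |s| into 1 - |s| reduce to the interval from [eta] to 1/2, where
    the cosine decreases. This keeps e^{2 pi i s} away from 1. *)
Lemma cos_2pi_le (eta s : R) : 0 <= eta -> eta <= `|s| <= 1 - eta ->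
  cos (2 * pi * s) <= cos (2 * pi * eta).
Proof.
move=> eta0; rewrite -(cos_norm (2 * pi * s)) normrM.
have p0 := pi_gt0 R.
rewrite (ger0_norm (_ : 0 <= 2 * pi :> R)); last by lra.
move: `|s| => r /andP[er r1].
have mono u : eta <= u -> u <= 1 / 2 -> cos (2 * pi * u) <= cos (2 * pi * eta).
  move=> eu u2; rewrite leNgt ltr_cos ?in_itv /= -?leNgt; nra.
have [r2|r2] := leP r (1 / 2); first exact: mono.
rewrite -cosN (_ : - (2 * pi * r) = 2 * pi * (1 - r) - pi *+ 2); last first.
  by rewrite -mulr_natl; ring.
rewrite -[X in X <= _](cosD2pi _) subrK; apply: mono; lra.
Qed.

(** With D the factor to divide by, 1/D is replaced by conj(D) / max(c0, |D|^2), which is bounded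
    everywhere. On [0, 1[ it equals 1/D at distance at least [delta] from [x]; nearer to [x], F
    vanishes. *)
Lemma L2_divide F x (delta : R) : L2 nu F -> 0 < x < 1 -> 0 < delta ->
  (forall t, 0 <= t < 1 -> `|t - x| < delta -> F t = 0) ->
  exists2 G : measurableTypeR R -> R[i], L2 nu G &
    {ae nu, forall t, F t = (fexp 1 (t - x) - 1) * G t}.
Proof.
move=> LF /andP[x0 x1] d0 F0.
have p0 := pi_gt0 R.
(* D also vanishes where t - x is 1 or -1; the bounds by x and 1 - x give |t - x| <= 1 - [eta] on
   [0, 1[. *)
pose eta := Num.min delta (Num.min x (1 - x)).
have [ed ex ex'] : [/\ eta <= delta, eta <= x & eta <= 1 - x].
  by rewrite /eta !ge_min !lexx ?orbT.
have e0 : 0 < eta by rewrite !lt_min d0 x0 subr_gt0 x1.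
pose D (t : R) := fexp 1 (t - x) - 1.
have DE t : normc (D t) ^+ 2 = 2 - 2 * cos (2 * pi * (t - x)).
  rewrite sqr_normc_ReIm /D cReD cImD /= oppr0 addr0 mulr1.
  by have := cos2Dsin2 (2 * pi * (t - x)); nra.
pose c0 := 2 - 2 * cos (2 * pi * eta).
have c00 : 0 < c0.
  have : cos (2 * pi * eta) < cos 0.
    rewrite ltr_cos ?in_itv /=; [by nra|by rewrite lexx ltW|].
    by apply/andP; split; nra.
  by rewrite cos0 /c0; lra.
have cD : cmeasurable (D : measurableTypeR R -> R[i]).
  apply: cmeasurableD; last exact: cmeasurable_cst.
  rewrite (_ : (fun t => _) = (fun t => fexp 1 t * fexp (- 1) x)).
    by apply: cmeasurableM; [exact: cmeasurable_fexp|exact: cmeasurable_cst].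
  by apply/funext => t; rewrite fexpDr fexpNr.
(* The reciprocal is written as a real power so that [measurable_powR] applies. *)
pose w (t : R) := Num.max c0 (normc (D t) ^+ 2) `^ (-1).
have wE t : w t = (Num.max c0 (normc (D t) ^+ 2))^-1.
  by rewrite /w powR_inv1// le_max ltW.
have w0 t : 0 < w t by rewrite wE invr_gt0 lt_max c00.
have wc t : w t <= c0^-1 by rewrite wE lef_pV2 ?posrE ?lt_max ?c00// le_max lexx.
pose m t := conjc (D t) * (w t)%:C%C.
exists (fun t => F t * m t).
  (* |D| is at most 2 and the weight [w] at most 1/c0. *)
  apply: (@L2_mul_bounded _ _ _ _ (2 * c0^-1)) => // [|t].
    apply: cmeasurableM; first exact: cmeasurableJ.
    split; last exact: measurable_cst.
    have mM : measurable_fun [set: measurableTypeR R]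
        (fun t => Num.max c0 (normc (D t) ^+ 2)).
      by apply: measurable_maxr => //; exact: measurable_normc_sqr.
    exact: (@measurableT_comp _ _ _ _ _ _ (@powR R ^~ (-1)) _ _ (measurable_powR _) mM).
  rewrite normcM; apply: ler_pM => //; try exact: normc_ge0.
    have : normc (conjc (D t)) ^+ 2 <= 2 ^+ 2.
      rewrite sqr_normc_ReIm cReJ cImJ sqrrN -sqr_normc_ReIm DE.
      by have := cos_geN1 (2 * pi * (t - x)); lra.
    by rewrite ler_pXn2r// nnegrE ?normc_ge0.
  by rewrite /= expr0n addr0 sqrtr_sqr gtr0_norm.
apply: (@ae_unit_measure _ x) => t /andP[t0 t1] tx.
have [td|td] := ltP `|t - x| delta.
  by rewrite F0 ?ltW// mul0r mulr0.
suff -> : D t * (F t * m t) = F t * (normc (D t) ^+ 2 * w t)%:C%C.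
  have c0D : c0 <= normc (D t) ^+ 2.
    have st : eta <= `|t - x| <= 1 - eta.
      rewrite (le_trans ed td) /= ler_norml; apply/andP; split; lra.
    by rewrite DE lerB// ler_pM2l// (cos_2pi_le (ltW e0) st).
  by rewrite wE (max_idPr c0D) divff ?mulr1// gt_eqF// (lt_le_trans c00).
have -> : (normc (D t) ^+ 2 * w t)%:C%C = D t * conjc (D t) * (w t)%:C%C.
  by rewrite mulcJ -rmorphM.
by rewrite /m; ring.
Qed.

Lemma localization0 F x (delta : R) : L2 nu F -> 0 < x < 1 -> 0 < delta ->
  (forall t, 0 <= t < 1 -> `|t - x| < delta -> F t = 0) ->
  ccvg (S F ^~ x) 0.
Proof.
move=> LF x01 d0 F0; have [G LG FG] := L2_divide LF x01 d0 F0.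
pose a n := L2dot nu G (E n) * fexp n x.
have sp := L2_semi_inner_product nu.
have LEG : L2 nu (fun t => G t * fexp 1 t).
  apply: (@L2_mul_bounded _ _ _ _ 1) => //; first exact: cmeasurable_fexp.
  by move=> t; rewrite normc_fexp.
(* Multiplying G by e^{2 pi i t} shifts its coefficients by one, and the factor e^{-2 pi i x} is
   absorbed into [a (n - 1)]. *)
have coefF n : L2dot nu F (E n) * fexp n x = a (n - 1) - a n.
  have -> : L2dot nu F (E n) =
      L2dot nu (fexp (- 1) x *: (fun t => G t * fexp 1 t) - G) (E n).
    apply: L2dot_ae_eq.
    - exact: L2_cmeasurable LF.
    - by apply: (@L2_cmeasurable _ _ _ nu); apply: (spB sp) => //; exact: (spZ sp).
    - exact: cmeasurable_fexp.
    apply: filterS FG => t ->.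
    rewrite -[RHS]/(fexp (- 1) x * (G t * fexp 1 t) - G t).
    by rewrite fexpDr fexpNr; ring.
  rewrite (dotBl sp)//; [|exact: (spZ sp)|exact: L2_fexp].
  rewrite (dotZl sp)//; last exact: L2_fexp.
  have -> : L2dot nu (fun t => G t * fexp 1 t) (E n) = L2dot nu G (E (n - 1)).
    have E1 t : G t * fexp 1 t * conjc (fexp n t) = G t * conjc (fexp (n - 1) t).
      by rewrite !fexpJ -mulrA -fexpD opprB.
    by rewrite /L2dot; congr Complex; apply: eq_Rintegral => t _; rewrite E1.
  rewrite mulrBl; congr (_ - _).
  by rewrite /a fexpD; ring.
have SF M : S F M x = a (- M.+1%:Z) - a M%:Z.
  (* The sign and the shift by M + 1 turn the terms into increments [b k.+1 - b k]; only the
     frequencies -M - 1 and M survive. *)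
  pose b k := - a (k%:Z - M.+1%:Z).
  rewrite fourier_sumE (eq_bigr (fun k : 'I__ => b k.+1 - b k)) => [|k _].
    rewrite -(big_mkord xpredT (fun k => b k.+1 - b k)) telescope_sumr// /b.
    rewrite sub0r opprK addrC; congr (_ - a _); rewrite -addnn; lia.
  rewrite coefF /b opprK addrC; congr (- a _ + a _); lia.
have [c0 c1] := coef_cvg0 sp (@L2_fexp R) (@fexp_orthonormal R) LG.
rewrite /ccvg; under eq_fun do rewrite subr0 SF.
have : 2 * normc (L2dot nu G (E (- M.+1%:Z))) ^+ 2 +
       2 * normc (L2dot nu G (E M%:Z)) ^+ 2 @[M --> \oo] --> (0 : R).
  have c1' : normc (L2dot nu G (E (- M.+1%:Z))) ^+ 2 @[M --> \oo] --> (0 : R).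
    by rewrite (@cvg_shiftS _ (fun M : nat => normc (L2dot nu G (E (- M%:Z))) ^+ 2)).
  have := cvgD (cvgMl_tmp (a := 2) c1') (cvgMl_tmp (a := 2) c0).
  by rewrite !mulr0 addr0; exact.
apply: squeeze_cvgr (@cvg_cst _ _ _ _ _); apply: nearW => M.
rewrite sqr_ge0 (le_trans (sqr_normcD_le _ _))//.
have na n : normc (a n) = normc (L2dot nu G (E n)).
  by rewrite normcM normc_fexp mulr1.
by rewrite normcN !na.
Qed.

Lemma fourier_sum_fexp0 M : S (E 0) M = E 0.
Proof.
rewrite /fourier_sum /symmetric_sum.
have M2 : (M < M.*2.+1)%N by rewrite ltnS -addnn leq_addr.
(* Frequency 0 sits at index k = M. *)
rewrite (bigD1 (Ordinal M2))//= subrr fexp_orthonormal eqxx scale1r big1 ?addr0//.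
move=> k kM; rewrite fexp_orthonormal.
case: eqP => [k0|]; last by rewrite scale0r.
by exfalso; move/eqP: kM; apply; apply: val_inj => /=; lia.
Qed.

(** Subtracting c times [E 0] reduces to [localization0], because [E 0] equals all its Fourier
    sums. *)
Lemma localization F x (c : R[i]) (delta : R) : L2 nu F ->
  0 < x < 1 -> 0 < delta ->
  (forall t, 0 <= t < 1 -> `|t - x| < delta -> F t = c) ->
  ccvg (S F ^~ x) c.
Proof.
move=> LF x01 d0 Fc; have sp := L2_semi_inner_product nu.
have LE : L2 nu (E 0) by exact: L2_fexp.
have LFc : L2 nu (- c *: E 0 + F).
  by apply: (spD sp) => //; exact: (spZ sp).
have := localization0 LFc x01 d0.
have E0 t : (- c *: E 0 + F) t = - c * 1 + F t.
  by rewrite -[LHS]/(- c * fexp 0 t + F t) fexp0.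
rewrite /ccvg => h.
rewrite (_ : (fun M => _) = fun M => normc (S (- c *: E 0 + F) M x - 0) ^+ 2).
  by apply: h => t t01 td; rewrite E0 Fc// mulr1 addNr.
apply/funext => M; rewrite (fourier_sumP sp (@L2_fexp R))// fourier_sum_fexp0.
by rewrite -[(_ + _) x]/(- c * fexp 0 x + S F M x) fexp0 mulr1 subr0 addrC.
Qed.

End localization.

(** * Completeness of the exponentials in L2([0, 1[) *)

Section completeness.
Variable R : realType.
Implicit Types (F H : measurableTypeR R -> R[i]) (x : R).

Local Notation nu := (@unit_measure R).
Local Notation E := (@fexp R : int -> measurableTypeR R -> R[i]).
Local Notation S := (fourier_sum (L2dot nu) E).
Local Notation total := (parseval_equality (L2 nu) (L2dot nu) E).

Let sp : semi_inner_product (L2 nu) (L2dot nu) := L2_semi_inner_product nu.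

(* Fatou: the integral of |F|^2 is at most liminf of the integrals of |S F M|^2,
   which are the energies of F; the converse is Bessel's inequality. *)
Lemma parseval_equality_ae_cvg F : L2 nu F ->
  {ae nu, forall x, ccvg (S F ^~ x) (F x)} -> total F.
Proof.
move=> LF SF; split => //.
have cE := energy_cvg sp (@L2_fexp R) (@fexp_orthonormal R) LF.
have LS M : L2 nu (S F M) by exact: (fourier_sum_in sp (@L2_fexp R)).
have mS M : measurable_fun [set: measurableTypeR R] (fun x => (normc (S F M x) ^+ 2)%:E).
  exact/measurable_EFinP/measurable_normc_sqr/(L2_cmeasurable (LS M)).
suff : hnorm (L2dot nu) F ^+ 2 <= limn (energy (L2dot nu) E F).
  move=> le1; suff <- : limn (energy (L2dot nu) E F) = hnorm (L2dot nu) F ^+ 2 by [].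
  apply/eqP; rewrite eq_le le1 andbT; apply: limr_le => //.
  by apply: nearW => M; exact: (energy_le sp (@L2_fexp R) (@fexp_orthonormal R)).
rewrite -lee_fin hnorm_L2//.
have -> : (\int[nu]_x (normc (F x) ^+ 2)%:E =
    \int[nu]_x limn_einf (fun M => (normc (S F M x) ^+ 2)%:E))%E.
  apply: ae_eq_integral => //.
  - exact/measurable_EFinP/measurable_normc_sqr/(L2_cmeasurable LF).
  (* Measurability of the lower limit is obtained from that of the upper limit of the negatives. *)
  - rewrite (_ : (fun x => _) =
        -%E \o (fun x => limn_esup (fun M => (- (normc (S F M x) ^+ 2)%:E)%E))).
      apply: measurableT_comp => //; apply: measurable_fun_limn_esup => M.
      exact: measurableT_comp.
    apply/funext => x /=; rewrite -limn_einfN; congr limn_einf.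
    by apply/funext => M; rewrite /= opprK.
  have FF := ae_filter_ringOfSetsType nu.
  apply: (@filterS _ _ FF _ _ _ SF) => x /ccvg_sqr_normc cx _.
  have : (normc (S F M x) ^+ 2)%:E @[M --> \oo] --> (normc (F x) ^+ 2)%:E.
    by apply: cvg_EFin; [by apply: nearW|exact: cx].
  by move=> h; rewrite is_cvg_limn_einfE ?(cvg_lim _ h).
have S0 M x : [set: measurableTypeR R] x -> (0 <= (normc (S F M x) ^+ 2)%:E)%E.
  by move=> _; rewrite lee_fin sqr_ge0.
apply: le_trans (@fatou _ _ _ nu setT measurableT
  (fun M x => (normc (S F M x) ^+ 2)%:E) mS S0) _.
under eq_fun do rewrite -hnorm_L2//
  (hnorm_fourier_sum sp (@L2_fexp R) (@fexp_orthonormal R))//.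
have h : (energy (L2dot nu) E F M)%:E @[M --> \oo] -->
    (limn (energy (L2dot nu) E F))%:E.
  by apply: cvg_EFin; [by apply: nearW|exact: cE].
by rewrite is_cvg_limn_einfE ?(cvg_lim _ h).
Qed.

(** Dominated convergence applied to |F - Fn|^2 gives convergence in norm, and
    [parseval_equality_closed] concludes. *)
Lemma parseval_equality_dominated (Fn : nat -> measurableTypeR R -> R[i]) F H :
  (forall n, total (Fn n)) -> L2 nu F -> L2 nu H ->
  (forall n x, normc (Fn n x) ^+ 2 <= normc (H x) ^+ 2) ->
  (forall x, ccvg (Fn ^~ x) (F x)) -> total F.
Proof.
move=> tF LF LH FH FnF.
have LB n : L2 nu (F - Fn n) by apply: (spB sp) => //; case: (tF n).
have mB n : measurable_fun [set: measurableTypeR R]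
    (fun x => (normc ((F - Fn n) x) ^+ 2)%:E).
  exact/measurable_EFinP/measurable_normc_sqr/(L2_cmeasurable (LB n)).
have cB x : (normc ((F - Fn n) x) ^+ 2)%:E @[n --> \oo] --> 0%E.
  apply: cvg_EFin; first by apply: nearW.
  rewrite (_ : _ \o _ = fun n => normc (Fn n x - F x) ^+ 2); first exact: FnF.
  by apply/funext => n; rewrite /= -normcN opprB.
(* This comes from |F - Fn|^2 <= 2|F|^2 + 2|Fn|^2. *)
pose g x := (2 * normc (F x) ^+ 2 + 2 * normc (H x) ^+ 2)%:E.
have ig : nu.-integrable [set: measurableTypeR R] g.
  by apply: EFin_integrableD => //; apply: EFin_integrableZl; exact: L2_integrable.
have cB' : {ae nu, forall x, [set: measurableTypeR R] x ->
    (normc ((F - Fn n) x) ^+ 2)%:E @[n --> \oo] --> (0%E : \bar R)}.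
  by apply: aeW => x _; exact: cB.
have bd : {ae nu, forall x n, [set: measurableTypeR R] x ->
    (`|(normc ((F - Fn n) x) ^+ 2)%:E| <= g x)%E}.
  apply: aeW => x n _; rewrite gee0_abs ?lee_fin ?sqr_ge0//.
  apply: le_trans (sqr_normcD_le _ _) _; rewrite normcN lerD2l.
  by rewrite ler_wpM2l.
have [_ _] := @dominated_convergence _ _ _ nu setT measurableT
  (fun n x => (normc ((F - Fn n) x) ^+ 2)%:E) (cst 0%E) g mB (measurable_cst _)
  cB' ig bd.
rewrite integral0 => c0.
apply: (parseval_equality_closed sp (@L2_fexp R) (@fexp_orthonormal R)) => // eps eps0.
have /fine_cvgP[_ /cvgrPdist_lt /(_ _ eps0) [N _ NP]] := c0.
exists (Fn N) => //; have := NP N (leqnn N).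
rewrite /= sub0r normrN -hnorm_L2//=.
by rewrite ger0_norm// sqr_ge0.
Qed.

Definition cindic (A : set (measurableTypeR R)) : measurableTypeR R -> R[i] :=
  fun x => (\1_A x)%:C%C.

Lemma L2_cindic A : measurable A -> L2 nu (cindic A).
Proof.
move=> mA; apply: (@L2_unit_bounded _ 1).
  by split; [exact: measurable_indic|exact: measurable_cst].
move=> x; rewrite /= expr0n addr0 sqrtr_sqr indicE.
by case: (x \in A); rewrite ?normr1// normr0.
Qed.

(** At any x other than [a] the indicator is constant within distance |x - a|, so localization gives
    convergence at every point of ]0, 1[ except [a]. *)
Lemma parseval_equality_ray (a : R) : total (cindic `[a, +oo[).
Proof.
apply: parseval_equality_ae_cvg; first exact: L2_cindic.
apply: (@ae_unit_measure _ a) => x x01 xa.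
apply: (@localization _ _ _ _ `|x - a|) => //.
- exact: L2_cindic.
- by rewrite normr_gt0 subr_eq0.
move=> t _ tx; congr (_%:C%C); rewrite !indicE; congr (_%:R).
rewrite !mem_setE !in_itv /= !andbT.
have [ax|ax] := leP a x.
  move: tx; rewrite [X in _ < X]ger0_norm ?subr_ge0// ltr_norml => tx.
  by rewrite (_ : a <= t)//; lra.
move: tx; rewrite [X in _ < X]ltr0_norm ?subr_lt0// ltr_norml => tx.
by rewrite leNgt (_ : t < a)//; lra.
Qed.

Let lin a F G : total F -> total G -> total (a *: F + G).
Proof. exact: (parseval_equality_lin sp (@L2_fexp R) (@fexp_orthonormal R)). Qed.

Lemma parseval_equality0 : total 0.
Proof.
have t0 := parseval_equality_ray 0.
rewrite (_ : 0 = - 1 *: cindic `[0, +oo[ + cindic `[0, +oo[); first exact: lin.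
by rewrite scaleN1r addNr.
Qed.

Lemma parseval_equality_sum (I : Type) (r : seq I) (a : I -> R[i])
    (Fn : I -> measurableTypeR R -> R[i]) :
  (forall i, total (Fn i)) -> total (\sum_(i <- r) a i *: Fn i).
Proof.
move=> tF; elim: r => [|i r ih]; first by rewrite big_nil; exact: parseval_equality0.
by rewrite big_cons; exact: lin.
Qed.

Lemma parseval_equality_cindicT : total (cindic setT).
Proof.
have E01 : cindic setT = E 0.
  by apply/funext => x; rewrite fexp0 /cindic indicT.
rewrite E01; apply: parseval_equality_ae_cvg; first exact: L2_fexp.
apply: aeW => x; rewrite /ccvg.
under eq_fun do rewrite fourier_sum_fexp0 subrr [normc 0]normc0 expr0n.
exact: cvg_cst.
Qed.

(** Closed rays form a pi-system generating the Borel sets. Complements follow by linearity,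
    countable disjoint unions by dominated convergence of the finite ones. *)
Lemma parseval_equality_cindic (A : set (measurableTypeR R)) :
  measurable A -> total (cindic A).
Proof.
have GE : @measurable _ (measurableTypeR R) = <<s @RGenCInfty.G R >>.
  exact: RGenCInfty.measurableE.
have tT := parseval_equality_cindicT.
move=> mA; have : <<s @RGenCInfty.G R >> A by rewrite -GE.
move: A {mA}.
apply: (@dynkin_induction _ _ (@RGenCInfty.G R) (fun A => total (cindic A)) GE _ tT).
- move=> _ _ [a ->] [b ->]; exists (Num.max a b).
  apply/seteqP; split=> x /=; rewrite !in_itv /= !andbT ge_max.
    by move=> [-> ->].
  by move=> /andP[].
- by move=> _ [a ->]; exact: parseval_equality_ray.
- move=> A mA tA.
  rewrite (_ : cindic _ = (- 1) *: cindic A + cindic setT); first exact: lin.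
  apply/funext => x; rewrite -[RHS]/(- 1 * cindic A x + cindic setT x).
  rewrite /cindic !indicE in_setC in_setT.
  by case: (x \in A); rewrite /= mulN1r ?addNr// oppr0 add0r.
- move=> F mF tF totF.
  pose B n := \bigcup_(k in `I_n) F k.
  have tB n : total (cindic (B n)).
    elim: n => [|n ih].
      rewrite (_ : cindic _ = 0); first exact: parseval_equality0.
      by apply/funext => x; rewrite /cindic /B II0 bigcup_set0 indic0.
    (* Disjointness makes the indicators add up. *)
    suff -> : cindic (B n.+1) = 1 *: cindic (B n) + cindic (F n).
      exact: (lin _ ih (totF n)).
    rewrite scale1r; apply/funext => x.
    rewrite -[RHS]/(cindic (B n) x + cindic (F n) x) -rmorphD.
    congr (_%:C%C); rewrite !indicE {1}/B IIS bigcup_setU bigcup_set1 in_setU -/(B n).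
    have [xB|_] := boolP (x \in B n); last by rewrite add0r.
    rewrite (_ : x \in F n = false) ?addr0//; apply/negbTE/negP.
    move=> /set_mem xFn; move: xB => /set_mem[k /= kn xFk].
    have /trivIsetP/(_ k n Logic.I Logic.I) := tF.
    rewrite (ltn_eqF kn) => /(_ isT) FkFn.
    by have : (F k `&` F n) x by []; rewrite FkFn.
  apply: (@parseval_equality_dominated (fun n => cindic (B n)) _ (cindic setT)) => //.
  + by apply: L2_cindic; exact: bigcupT_measurable.
  + exact: L2_cindic.
  + move=> n x; rewrite !sqr_normc_ReIm /= !indicE in_setT !lerD2r.
    by case: (x \in _); rewrite // expr0n expr1n ler01.
  (* At a fixed x the indicators of the finite unions are eventually constant: from n = k + 1 on if
     x lies in [F k], always 0 if x lies in none. *)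
  + move=> x; apply: cvg_near_cst.
    have [[k _ xFk]|nx] := pselect ((\bigcup_k F k) x).
      exists k.+1 => // n kn; rewrite /cindic !indicE !mem_set//; [|by exists k..].
      by rewrite subrr normc0 expr0n.
    apply: nearW => n; rewrite /cindic !indicE !memNset ?subrr ?normc0 ?expr0n//.
    by move=> [k _ xFk]; apply: nx; exists k.
Qed.

Import HBNNSimple.

Lemma parseval_equality_nnsfun (f : {nnsfun (measurableTypeR R) >-> R}) :
  total (fun x => (f x)%:C%C).
Proof.
pose s := fset_set (range f).
rewrite (_ : (fun x => _) =
    \sum_(y <- s) y%:C%C *: cindic (f @^-1` [set y])).
  by apply: parseval_equality_sum => y; exact: parseval_equality_cindic.
apply/funext => x; rewrite fct_sumE fimfunE fsbig_finite//= rmorph_sum.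
by apply: eq_bigr => y _; rewrite rmorphM.
Qed.

(** Simple functions increase to [u], so [u] itself dominates them. *)
Lemma parseval_equality_ge0 (u : measurableTypeR R -> R) :
  L2 nu (fun x => (u x)%:C%C) -> (forall x, 0 <= u x) ->
  total (fun x => (u x)%:C%C).
Proof.
move=> Lu u0.
have mu : measurable_fun [set: measurableTypeR R] (EFin \o u).
  by apply/measurable_EFinP; case: Lu.
pose un := nnsfun_approx measurableT mu.
have unu x : un n x @[n --> \oo] --> u x.
  have := @cvg_nnsfun_approx _ _ _ _ measurableT _ mu (fun x _ => u0 x) x Logic.I.
  by move=> /fine_cvgP[].
apply: (@parseval_equality_dominated (fun n x => (un n x)%:C%C) _ (fun x => (u x)%:C%C)) => //.
- by move=> n; exact: parseval_equality_nnsfun.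
- move=> n x; rewrite /= expr0n /= !addr0 !sqrtr_sqr.
  rewrite !ger0_norm// ler_pXn2r ?nnegrE//.
  have nd : nondecreasing_seq (un ^~ x).
    by move=> m k mk; have /lefP := nd_nnsfun_approx measurableT mu mk; exact.
  by have := nondecreasing_cvgn_le nd (cvgP _ (unu x)) n; rewrite (cvg_lim _ (unu x)).
- move=> x; rewrite /ccvg.
  rewrite (_ : (fun n => _) = fun n => (un n x - u x) ^+ 2).
    have := cvgM (cvgB (unu x) (cvg_cst (u x))) (cvgB (unu x) (cvg_cst (u x))).
    by rewrite subrr mulr0; exact.
  by apply/funext => n; rewrite sqr_normc_ReIm /= subr0 expr0n addr0.
Qed.

Theorem parseval_equality_L2 F : L2 nu F -> total F.
Proof.
move=> LF; have [mr mi _] := LF.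
(* To be used for the real and imaginary parts of F; the bound by |F| puts them and their positive
   and negative parts in L2. *)
have tpos (u : measurableTypeR R -> R) :
    measurable_fun [set: measurableTypeR R] u ->
    (forall x, u x ^+ 2 <= normc (F x) ^+ 2) -> total (fun x => (u x)%:C%C).
  move=> mu uF.
  have tmax (v : measurableTypeR R -> R) : measurable_fun [set: measurableTypeR R] v ->
      (forall x, v x ^+ 2 <= normc (F x) ^+ 2) ->
      total (fun x => (Num.max (v x) 0)%:C%C).
    move=> mv vF; apply: parseval_equality_ge0; last by move=> x; rewrite le_max lexx orbT.
    apply: (L2_dominated _ LF (L2_0 nu)).
      split; last exact: measurable_cst.
      by apply: measurable_maxr => //; exact: measurable_cst.
    move=> x; rewrite [X in _ <= _ + X](_ : _ = 0); last first.
      by rewrite [normc _]normc0 expr0n.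
    rewrite addr0 [leLHS]sqr_normc_ReIm /= expr0n addr0; apply: le_trans (vF x).
    by rewrite maxEle; case: ifP => // _; rewrite expr0n sqr_ge0.
  rewrite (_ : (fun x => _) = (- 1) *: (fun x => (Num.max (- u x) 0)%:C%C) +
                             (fun x => (Num.max (u x) 0)%:C%C)).
    apply: lin; last exact: tmax.
    by apply: tmax; [exact: measurable_funN|move=> x; rewrite sqrrN].
  apply/funext => x; rewrite -[RHS]/(- 1 * _%:C%C + _%:C%C) mulN1r -rmorphN -rmorphD.
  congr (_%:C%C); rewrite !maxEle oppr_le0.
  have [|] := leP (u x) 0; have [|] := leP 0 (u x); lra.
rewrite (_ : F = 'i%C *: (fun x => (complex.Im (F x))%:C%C) +
                 (fun x => (complex.Re (F x))%:C%C)).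
  apply: lin; apply: tpos => // x; rewrite sqr_normc_ReIm ?lerDl ?lerDr sqr_ge0//.
by apply/funext => x; rewrite {1}[F x]complexE addrC.
Qed.

End completeness.

(** * The map [collapse], the dual frame and the transfer to L2(mu) *)

Section collapse.
Variable R : realType.
Local Notation T := (measurableTypeR R).
Local Notation nu := (@unit_measure R).
Local Notation E := (@fexp R : int -> T -> R[i]).
Local Notation S := (fourier_sum (L2dot nu) E).

Let sp : semi_inner_product (L2 nu) (L2dot nu) := L2_semi_inner_product nu.

(** Negative reals also go to 1/4; they form a null set for [nu]. The ray [J] below is the part of
    the line that is contracted. *)
Definition collapse (x : T) : T := if x < 2^-1 then 4^-1 else x.

Lemma half_lt1 : (2^-1 : R) < 1. Proof. lra. Qed.

Lemma measurable_collapse : measurable_fun [set: T] collapse.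
Proof.
apply: measurable_fun_ifT => //.
exact: measurable_fun_ltr.
Qed.

HB.instance Definition _ :=
  @isMeasurableFun.Build _ _ T T collapse measurable_collapse.

Variable mu : {measure set T -> \bar R}.
Hypothesis mu_collapse : forall A, measurable A -> mu A = pushforward nu collapse A.

Lemma ge0_integral_collapse (h : T -> \bar R) : measurable_fun [set: T] h ->
  (forall x, (0 <= h x)%E) -> (\int[mu]_x h x = \int[nu]_x h (collapse x))%E.
Proof.
move=> mh h0.
rewrite (eq_measure_integral (pushforward nu collapse)); last first.
  by move=> A mA _; exact: mu_collapse.
by rewrite (ge0_integral_pushforward measurable_collapse).
Qed.

Lemma Rintegral_collapse (h : T -> R) :
  nu.-integrable [set: T] (EFin \o (h \o collapse)) -> measurable_fun [set: T] h ->
  \int[mu]_x h x = \int[nu]_x h (collapse x).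
Proof.
move=> ih mh; rewrite /Rintegral; congr fine.
rewrite (eq_measure_integral (pushforward nu collapse)); last first.
  by move=> A mA _; exact: mu_collapse.
by rewrite (integral_pushforward measurable_collapse)//; exact/measurable_EFinP.
Qed.

Lemma cmeasurable_collapse (h : T -> R[i]) : cmeasurable h -> cmeasurable (h \o collapse).
Proof.
move=> [hr hi]; split.
- exact: (measurableT_comp hr measurable_collapse).
- exact: (measurableT_comp hi measurable_collapse).
Qed.

Lemma L2_collapse (h : T -> R[i]) : cmeasurable h -> L2 mu h <-> L2 nu (h \o collapse).
Proof.
move=> mh; have [r i] := mh; have [r' i'] := cmeasurable_collapse mh.
have E1 : (\int[mu]_x (normc (h x) ^+ 2)%:E =
    \int[nu]_x (normc ((h \o collapse) x) ^+ 2)%:E)%E.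
  apply: ge0_integral_collapse; last by move=> x; rewrite lee_fin sqr_ge0.
  exact/measurable_EFinP/measurable_normc_sqr.
by split => -[_ _ foo]; split => //; rewrite ?E1// -E1.
Qed.

Lemma L2dot_collapse (f g : T -> R[i]) : L2 mu f -> L2 mu g ->
  L2dot mu f g = L2dot nu (f \o collapse) (g \o collapse).
Proof.
move=> Lf Lg; have [mf mg] := (L2_cmeasurable Lf, L2_cmeasurable Lg).
have [Lf' Lg'] := ((L2_collapse mf).1 Lf, (L2_collapse mg).1 Lg).
have [ir ii] := L2_mulJ_integrable Lf' Lg'.
have [mr mi] := cmeasurableM mf (cmeasurableJ mg).
by rewrite /L2dot (Rintegral_collapse ir mr) (Rintegral_collapse ii mi).
Qed.

Local Notation J := (`]-oo, (2^-1 : R)[%classic).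

Lemma cindicE x : cindic J x = if x < 2^-1 then 1 else 0.
Proof. by rewrite /cindic indicE mem_setE in_itv /=; case: ifP. Qed.

Lemma L2_J : L2 nu (cindic J).
Proof. exact: L2_cindic. Qed.

Lemma L2dot_J1 : L2dot nu (cindic J) (E 0) = (2^-1)%:C%C.
Proof.
have E1 x : cindic J x * conjc (fexp 0 x) = (\1_J x)%:C%C.
  by rewrite fexp0 rmorph1 mulr1.
rewrite /L2dot -[RHS]/(Complex 2^-1 0); congr Complex.
  under eq_Rintegral do rewrite E1.
  rewrite /Rintegral integral_indic// setIT unit_measureE.
  rewrite (_ : _ `&` _ = `[0, 2^-1[%classic).
    by rewrite lebesgue_measure_itv /= lte_fin invr_gt0 ltr0n /= subr0.
  apply/seteqP; split => x /=; rewrite !in_itv /=.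
    by move=> [-> /andP[-> _]].
  by move=> /andP[-> x2]; rewrite x2 (lt_trans x2)// half_lt1.
under eq_Rintegral do rewrite E1.
by rewrite /Rintegral integral0.
Qed.

(* The conditional expectation of [E n] given [collapse]: its mean on [0, 1/2[,
   and [E n] on [1/2, 1[. *)
Definition dual n : T -> R[i] :=
  (2%:R * L2dot nu (E n) (cindic J)) *: cindic J + E n - (fun x => E n x * cindic J x).

Lemma dualE n x : dual n x =
  if x < 2^-1 then 2%:R * L2dot nu (E n) (cindic J) else E n x.
Proof.
rewrite -[LHS]/(_ * cindic J x + E n x - E n x * cindic J x) cindicE.
by case: ifP => _; ring.
Qed.

(** [dual n] is constant on the contracted ray, which contains 1/4. Hence the same function serves
    in L2(mu) and as its own image in L2(nu). *)
Lemma dual_collapse n : dual n \o collapse = dual n.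
Proof.
apply/funext => x; rewrite /= !dualE /collapse; have [x2|x2] := ltP x 2^-1.
  by rewrite ifT//; lra.
by rewrite ltNge x2.
Qed.

Lemma L2_EJ n : L2 nu (fun x => E n x * cindic J x).
Proof.
apply: (@L2_mul_bounded _ _ _ _ 1) => //.
- exact/L2_cmeasurable/L2_J.
- by move=> x; rewrite cindicE; case: ifP => _; rewrite ?normc1 ?normc0 ?ler01.
- exact: L2_fexp.
Qed.

Lemma L2_dual_nu n : L2 nu (dual n).
Proof.
apply: (spB sp); last exact: L2_EJ.
by apply: (spD sp); [apply: (spZ sp); exact: L2_J|exact: L2_fexp].
Qed.

Lemma L2_dual n : L2 mu (dual n).
Proof.
apply/L2_collapse; first exact: (L2_cmeasurable (L2_dual_nu n)).
by rewrite dual_collapse; exact: L2_dual_nu.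
Qed.

(** This is the adjoint relation: [E n - dual n] vanishes from 1/2 on and has mean zero on [0, 1/2[,
    where [f \o collapse] is constant. *)
Lemma L2dot_dual f n : L2 mu f ->
  L2dot mu f (dual n) = L2dot nu (f \o collapse) (E n).
Proof.
move=> Lf; rewrite L2dot_collapse//; last exact: L2_dual.
rewrite dual_collapse; have LF := (L2_collapse (L2_cmeasurable Lf)).1 Lf.
apply/eqP; rewrite eq_sym -subr_eq0; apply/eqP.
rewrite -(dotBr sp) //; [|exact: L2_fexp|exact: L2_dual_nu].
(* Both integrands vanish from 1/2 on; on [J] the function [dual n] is a constant, here written as a
   multiple of [E 0]. *)
have -> : L2dot nu (f \o collapse) (E n - dual n) =
    L2dot nu (f 4^-1 *: cindic J)
      (E n - (2%:R * L2dot nu (E n) (cindic J)) *: E 0).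
  have E1 x : (f \o collapse) x * conjc ((E n - dual n) x) =
      (f 4^-1 *: cindic J) x *
      conjc ((E n - (2%:R * L2dot nu (E n) (cindic J)) *: E 0) x).
    rewrite -[(E n - dual n) x]/(E n x - dual n x) dualE.
    rewrite -[(E n - _ *: E 0) x]/(E n x - _ * fexp 0 x) fexp0 mulr1.
    rewrite -[(f 4^-1 *: cindic J) x]/(f 4^-1 * cindic J x) cindicE.
    by rewrite /= /collapse; case: ifP => _; rewrite ?mulr1// subrr rmorph0 !mulr0 mul0r.
  by rewrite /L2dot; congr Complex; apply: eq_Rintegral => x _; rewrite E1.
have LE k : L2 nu (E k) by exact: L2_fexp.
have LJ := L2_J.
rewrite (dotZl sp)//; last by apply: (spB sp) => //; exact: (spZ sp).
rewrite (dotBr sp)//; last exact: (spZ sp).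
(* The factor 2 in [dual] cancels against the mass 1/2 of [0, 1/2[. *)
rewrite (dotZr sp)// L2dot_J1 (dotC sp (LE n) LJ) rmorphM rmorph_nat.
have h2 : (2%:R : R[i]) * (2^-1)%:C%C = 1.
  by rewrite -(rmorph_nat (real_complex R)) -rmorphM divff// rmorph1.
by rewrite mulrAC h2 mul1r subrr mulr0.
Qed.

Lemma parseval_frame_dual : parseval_frame (L2 mu) (L2dot mu) dual.
Proof.
split=> [n|f Lf]; first exact: L2_dual.
have LF := (L2_collapse (L2_cmeasurable Lf)).1 Lf.
under eq_esum do rewrite L2dot_dual//.
rewrite (parseval_equality_esum sp (@L2_fexp R) (@fexp_orthonormal R)
  (parseval_equality_L2 LF)).
by rewrite /hnorm -(L2dot_collapse Lf Lf).
Qed.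

Lemma L2_fexp_collapse n : L2 mu (E n).
Proof.
apply/L2_collapse; first exact: cmeasurable_fexp.
apply: (@L2_unit_bounded _ 1) => [|x]; last by rewrite normc_fexp.
exact/cmeasurable_collapse/cmeasurable_fexp.
Qed.

Lemma dextrodual_dual : dextrodual (L2 mu) (L2dot mu) dual E.
Proof.
split=> [n|n|f Lf]; [exact: L2_dual|exact: L2_fexp_collapse|].
pose F := f \o collapse.
have LF : L2 nu F := (L2_collapse (L2_cmeasurable Lf)).1 Lf.
have SE M : symmetric_sum (fun n => L2dot mu f (dual n) *: E n) M = S F M.
  by apply: eq_bigr => k _; rewrite L2dot_dual.
have LSmu M : L2 mu (S F M).
  by apply: (sp_sum (L2_semi_inner_product mu)) => k; apply: L2Z; exact: L2_fexp_collapse.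
have LS M : L2 nu (S F M) by exact: (fourier_sum_in sp (@L2_fexp R)).
(* F is constant within distance 1/4 of the point 1/4. *)
have S4 : ccvg (S F ^~ 4^-1) (f 4^-1).
  apply: (@localization _ _ _ _ 4^-1) => //; [by lra|].
  move=> t _; rewrite ltr_norml => t4; rewrite /F /= /collapse ifT//; lra.
have SF := (parseval_equalityP sp (@L2_fexp R) (@fexp_orthonormal R) LF).1
    (parseval_equality_L2 LF).
(* Pulled back by [collapse], the error is its value at the atom on [0, 1/2[ and the error of F on
   [1/2, 1[. Each is bounded by a term integrated over all of [0, 1[, which has mass 1. *)
have bound M : hnorm (L2dot mu) (f - S F M) ^+ 2 <=
    normc (S F M 4^-1 - f 4^-1) ^+ 2 + hnorm (L2dot nu) (F - S F M) ^+ 2.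
  have LfS : L2 mu (f - S F M) by exact: (spB (L2_semi_inner_product mu)).
  have LFS : L2 nu (F - S F M) by exact: (spB sp).
  rewrite -lee_fin EFinD !hnorm_L2// ge0_integral_collapse; last 2 first.
  - exact/measurable_EFinP/measurable_normc_sqr/(L2_cmeasurable LfS).
  - by move=> x; rewrite lee_fin sqr_ge0.
  set K := normc (_ - _) ^+ 2.
  have -> : (K%:E = \int[nu]_x (cst K%:E) x)%E.
    by rewrite integral_cst// unit_measureT mule1.
  have K0 : 0 <= K by exact: sqr_ge0.
  have mFS := measurable_normc_sqr (L2_cmeasurable LFS).
  rewrite -ge0_integralD//; last 2 first.
  - by move=> x _; rewrite lee_fin sqr_ge0.
  - exact/measurable_EFinP.
  apply: ge0_le_integral => //.
  - by move=> x _; rewrite lee_fin sqr_ge0.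
  - apply/measurable_EFinP/measurable_normc_sqr.
    exact/(cmeasurable_collapse (L2_cmeasurable LfS)).
  - by apply/measurable_EFinP; apply: measurable_funD.
  move=> x _; rewrite /= -EFinD lee_fin.
  rewrite -[(f - S F M) (collapse x)]/(f (collapse x) - S F M (collapse x)).
  rewrite -[(F - S F M) x]/(f (collapse x) - S F M x) /collapse.
  have [x2|x2] := ltP x 2^-1; last by rewrite lerDr.
  by rewrite -normcN opprB lerDl sqr_ge0.
under eq_fun do rewrite SE.
rewrite (_ : (fun M => _) =
    fun M => Num.sqrt (hnorm (L2dot mu) (f - S F M) ^+ 2)); last first.
  by apply/funext => M; rewrite sqrtr_sqr ger0_norm// hnorm_ge0.
have h0 : hnorm (L2dot mu) (f - S F M) ^+ 2 @[M --> \oo] --> (0 : R).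
  have hb : normc (S F M 4^-1 - f 4^-1) ^+ 2 + hnorm (L2dot nu) (F - S F M) ^+ 2
      @[M --> \oo] --> (0 : R).
    by have := cvgD S4 SF; rewrite addr0; exact.
  apply: (squeeze_cvgr _ (@cvg_cst _ _ _ _ _) hb); apply: nearW => M.
  by rewrite sqr_ge0 bound.
by have := continuous_cvg _ (@sqrt_continuous R 0) h0; rewrite sqrtr0; exact.
Qed.

End collapse.

(** * Identification of the measure of the theorem as an image measure *)

Section proposition.
Variable R : realType.
Local Notation T := (measurableTypeR R).

(** The density is prescribed on [0, 1[ only, so a set is first cut down to [0, 1[, which carries
    [mua]; there Radon-Nikodym turns the measure into the integral of the indicator. *)
Lemma density_measureE (mua : {finite_measure set T -> \bar R}) :
  mua (~` [set` `[0, 1[]) = 0%E -> mua `<< (@lebesgue_measure R) ->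
  ae_eq (@lebesgue_measure R) [set` `[0, 1[]
    ('d (charge_of_finite_measure mua) '/d (@lebesgue_measure R))
    (fun x => (\1_([set` `[2^-1, 1[]) x)%:E) ->
  forall A, measurable A -> mua A = lebesgue_measure (A `&` `[2^-1, 1[).
Proof.
move=> mua_on mua_ac mua_density A mA.
pose D := `[(0 : R), 1[%classic; pose I := `[(2^-1 : R), 1[%classic.
have mD : measurable (D : set T) by exact: measurable_itv.
have mI : measurable (I : set T) by exact: measurable_itv.
have mAD : measurable (A `&` D) by exact: measurableI.
have -> : mua A = mua (A `&` D).
  have A0 : mua (A `\` D) = 0%E.
    apply: (subset_measure0 (measurableD mA mD) (measurableC mD) _ mua_on).
    by move=> x [].
  transitivity (mua (A `\` D) + mua (A `&` D))%E; first exact: measureDI.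
  by rewrite A0 add0e.
rewrite -[LHS]/(charge_of_finite_measure mua (A `&` D)).
rewrite (@Radon_Nikodym_integral _ _ _ _ (@lebesgue_measure R))//.
transitivity (\int[@lebesgue_measure R]_(x in A `&` D) (\1_I x)%:E)%E.
  apply: ae_eq_integral => //.
  - exact/measurable_funTS/(measurable_int _ (Radon_Nikodym_integrable _)).
  - by apply/measurable_funTS/measurable_EFinP; exact: measurable_indic.
  - by apply: ae_eq_subset mua_density => x [].
rewrite integral_indic//; congr (lebesgue_measure _).
apply/seteqP; split=> x /=; rewrite /I /D /= !in_itv /=.
  by move=> [? [? ?]].
by move=> [Ax /andP[x2 x1]]; rewrite x1 x2 (le_trans _ x2)// invr_ge0 ler0n.
Qed.

(** The preimage of A contains all or none of [0, 1/2[, according to whether 1/4 lies in A, which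
    produces the atom of mass 1/2; on [1/2, 1[ it coincides with A. *)
Lemma collapse_measureE (mua : {finite_measure set T -> \bar R}) :
  (forall A, measurable A -> mua A = lebesgue_measure (A `&` `[(2^-1 : R), 1[)) ->
  forall A, measurable A ->
  measure_add (mscale (2^-1)%:nng (dirac (4^-1 : T))) mua A =
    pushforward (unit_measure R) (@collapse R) A.
Proof.
move=> muaE A mA; rewrite /measure_add /msum /= !big_ord_recl big_ord0 /= adde0.
rewrite muaE// /pushforward unit_measureE.
have mcA : measurable (@collapse R @^-1` A).
  by rewrite -[_ @^-1` _]setTI; exact: measurable_collapse.
pose D := `[(0 : R), 2^-1[%classic; pose I := `[(2^-1 : R), 1[%classic.
have cD x : D x -> collapse x = 4^-1.
  by rewrite /D /= in_itv /= => /andP[_ x2]; rewrite /collapse x2.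
have cI x : I x -> collapse x = x.
  by rewrite /I /= in_itv /= => /andP[x2 _]; rewrite /collapse ltNge x2.
have DI : `[(0 : R), 1[%classic = D `|` I.
  by rewrite -itv_bndbnd_setU ?bnd_simp//; lra.
have mD : measurable (D : set T) by exact: measurable_itv.
have mI : measurable (I : set T) by exact: measurable_itv.
rewrite DI setIUr measureU; last 3 first.
- exact: measurableI mcA mD.
- exact: measurableI mcA mI.
- apply/seteqP; split=> // x [[_ +] [_ +]].
  by rewrite /D /I /= !in_itv /= => /andP[_ x2] /andP[]; rewrite leNgt x2.
congr (_ + _)%E.
  rewrite /mscale /= diracE; have [/set_mem A4|A4] := boolP (4^-1 \in A).
    rewrite mule1 (_ : _ `&` _ = D).
      by rewrite lebesgue_measure_itv /= lte_fin invr_gt0 ltr0n /= sube0.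
    by apply/seteqP; split=> [x []//|x Dx]; split=> //=; rewrite cD.
  rewrite mule0 (_ : _ `&` _ = set0) ?measure0//.
  apply/seteqP; split=> // x [/= + Dx]; rewrite cD// => A4'.
  by move: A4; rewrite mem_set.
congr (lebesgue_measure _); apply/seteqP; split=> x [/= Ax Ix]; split=> //=.
  by rewrite cI.
by move: Ax; rewrite cI.
Qed.

End proposition.

Theorem proposition3p8 (R : realType)
    (mua : {finite_measure set (measurableTypeR R) -> \bar R})
    (mua_on : mua (~` [set` `[0, 1[]) = 0%E)
    (mua_ac : mua `<< (@lebesgue_measure R))
    (mua_density :
       ae_eq (@lebesgue_measure R) [set` `[0, 1[]
         ('d (charge_of_finite_measure mua) '/d (@lebesgue_measure R))
         (fun x => (\1_([set` `[2^-1, 1[]) x)%:E)) :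
  let mu :=
    measure_add (mscale (2^-1)%:nng (dirac (4^-1 : measurableTypeR R))) mua in
  exists g : int -> measurableTypeR R -> R[i],
    parseval_frame (L2 mu) (L2dot mu) g /\
    dextrodual (L2 mu) (L2dot mu) g (fun n x => expi (2 * pi * n%:~R * x)).
Proof.
move=> mu.
have muE := collapse_measureE (density_measureE mua_on mua_ac mua_density).
exists (@dual R); split; first exact: parseval_frame_dual muE.
exact: dextrodual_dual muE.
Qed.
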